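(* Let $f:\mathbb{R}^m\to\mathbb{R}^m$ and $g:\mathbb{R}^m\to\mathbb{R}^{m\times d}$ be locally Lipschitz, i.e. for every $R>0$ there is $C_R$ such that $\|f(x)-f(y)\|+\|g(x)-g(y)\|\le C_R\|x-y\|$ whenever $\|x\|,\|y\|\le R$. Let $\alpha,\beta>0$ be constants such that for all $x\in\mathbb{R}^m$ $$\langle x,f(x)\rangle\le-\alpha\|x\|^2+\beta,\qquad \|g(x)\|^2\le\beta,$$ and let $g$ be non-degenerate ($g(x)g(x)^T$ is invertible for every $x$). Let $0<h_{\max}<\infty$ and let $h:\mathbb{R}^m\to(0,h_{\max}]$ be a continuous function such that for all $x\in\mathbb{R}^m$ $$\langle x,f(x)\rangle+\tfrac12\,h(x)\,\|f(x)\|^2\le-\alpha\|x\|^2+\beta .$$ Let $\widehat X$ be the continuous interpolant and $\overline X$ the piecewise constant interpolant of the adaptive Euler-Maruyama discretisation with timestep function $h$ and initial value $x_0\in\mathbb{R}^m$. Then for every $p\in(0,\infty)$ there exists a constant $C_p$, depending solely on $p$, $x_0$, $h_{\max}$, $\alpha$ and $\beta$ (for fixed dimensions $m,d$), such that for all $t\ge0$ $$\mathbb{E}\big[\|\widehat X_t\|^p\big]<C_p,\qquad \mathbb{E}\big[\|\overline X_t\|^p\big]<C_p .$$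
   Context: $\|\cdot\|$ is the Euclidean norm for vectors and the Frobenius norm for matrices; $W$ is a standard $d$-dimensional Brownian motion on a filtered probability space. The underlying SDE is $dX_t=f(X_t)\,dt+g(X_t)\,dW_t$. Adaptive Euler-Maruyama discretisation with timestep function $h$: $t_0=0$, $\widehat X_0=x_0$ (fixed), $h_n=h(\widehat X_{t_n})$, $t_{n+1}=t_n+h_n$, $\Delta W_n=W_{t_{n+1}}-W_{t_n}$, and $$\widehat X_{t_{n+1}}=\widehat X_{t_n}+f(\widehat X_{t_n})\,h_n+g(\widehat X_{t_n})\,\Delta W_n .$$ For $t\ge0$ put $\underline t=\max\{t_n:\ t_n\le t\}$. The piecewise constant interpolant is $\overline X_t=\widehat X_{\underline t}$, and the continuous interpolant is $\widehat X_t=\widehat X_{\underline t}+f(\widehat X_{\underline t})(t-\underline t)+g(\widehat X_{\underline t})(W_t-W_{\underline t})$. These are defined for all $t\ge 0$ on the event $t_n\to\infty$, which has probability one under the stated hypotheses. *)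

(* Defs.v *)
From HB Require Import structures.
From mathcomp Require Import all_boot all_order all_algebra.
From mathcomp Require Import all_classical all_reals all_analysis.

Set Implicit Arguments.
Unset Strict Implicit.
Unset Printing Implicit Defensive.

Import Order.TTheory GRing.Theory Num.Theory.
Import numFieldNormedType.Exports.

Local Open Scope classical_set_scope.
Local Open Scope ring_scope.

(* Frobenius norm; on column vectors it is the Euclidean norm.  The norm `|A|
   that the library puts on matrices is the sup norm. *)
Definition fnorm (R : realType) (m n : nat) (A : 'M[R]_(m, n)) : R :=
  Num.sqrt (\sum_i \sum_j A i j ^+ 2).

Definition dotv (R : realType) (m : nat) (x y : 'cV[R]_m) : R :=
  \sum_i x i 0 * y i 0.

Definition locally_lipschitz (R : realType) (m d : nat)
    (f : 'cV[R]_m -> 'cV[R]_m) (g : 'cV[R]_m -> 'M[R]_(m, d)) : Prop :=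
  forall r : R, 0 < r -> exists C : R, forall x y : 'cV[R]_m,
    fnorm x <= r -> fnorm y <= r ->
    fnorm (f x - f y) + fnorm (g x - g y) <= C * fnorm (x - y).

(* Time is the half-line [0, +oo[: values at negative times are unconstrained,
   here and in brownian_motion. *)
Definition filtration (R : realType) (disp : measure_display)
    (T : measurableType disp) (F : R -> set (set T)) : Prop :=
  [/\ forall t, 0 <= t -> sigma_algebra setT (F t),
      forall t, 0 <= t -> F t `<=` measurable &
      forall s t, 0 <= s -> s <= t -> F s `<=` F t].

(* Standard d-dimensional Brownian motion relative to F, with the convention
   that every path is continuous.  The last two clauses say that W t - W s is
   independent of F s, and that its law is N(0, (t - s) I_d), i.e. its d
   coordinates are independent with law N(0, t - s); the second parameter of
   normal_prob is the standard deviation. *)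
Definition brownian_motion (R : realType) (disp : measure_display)
    (T : measurableType disp) (P : probability T R) (F : R -> set (set T))
    (d : nat) (W : R -> T -> 'cV[R]_d) : Prop :=
  [/\ forall t, 0 <= t -> forall (i : 'I_d) (B : set R), measurable B ->
        F t ((fun w => W t w i 0) @^-1` B),
      {ae P, forall w, W 0 w = 0},
      forall w, {within [set t : R | 0 <= t], continuous (W ^~ w)},
      forall s t, 0 <= s -> s < t -> forall A E : set T, F s A ->
        g_sigma_preimage (fun (i : 'I_d) w => W t w i 0 - W s w i 0) E ->
        P (A `&` E) = (P A * P E)%E &
      forall s t, 0 <= s -> s < t ->
        forall B : 'I_d -> set R, (forall i, measurable (B i)) ->
        P [set w | forall i, B i (W t w i 0 - W s w i 0)] =
        (\prod_(i < d) normal_prob 0 (Num.sqrt (t - s)) (B i))%E].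

Section adaptive_euler_maruyama.
Context (R : realType) (m d : nat).
Variables (f : 'cV[R]_m -> 'cV[R]_m) (g : 'cV[R]_m -> 'M[R]_(m, d)).
Variables (h : 'cV[R]_m -> R) (x0 : 'cV[R]_m).
(* a path of the driving Brownian motion *)
Variable W : R -> 'cV[R]_d.

(* the pair (t_n, X_{t_n}) *)
Fixpoint em (n : nat) : R * 'cV[R]_m :=
  if n is n'.+1 then
    let: (t, x) := em n' in
    (t + h x, x + h x *: f x + g x *m (W (t + h x) - W t))
  else (0, x0).

Definition em_time (n : nat) : R := (em n).1.
Definition em_state (n : nat) : 'cV[R]_m := (em n).2.

(* The index n at which max {t_n | t_n <= t} is attained.  It is unique when
   h > 0, and exists for all t >= 0 when t_n --> +oo; if there is no maximum,
   get returns the meaningless default index 0. *)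
Definition em_index (t : R) : nat :=
  get [set n | em_time n <= t /\
               forall k, em_time k <= t -> em_time k <= em_time n].

Definition em_piecewise (t : R) : 'cV[R]_m := em_state (em_index t).

Definition em_interp (t : R) : 'cV[R]_m :=
  let s := em_time (em_index t) in
  let x := em_state (em_index t) in
  x + (t - s) *: f x + g x *m (W t - W s).

End adaptive_euler_maruyama.

(* Main.v *)
(** A quantitative Foster-Lyapunov argument for V(x) = exp(lam |x|^2), with no
stochastic calculus.  If a step of length dl <= h(x) is taken from x, then
|x + dl f(x)|^2 <= (1 - 2 alpha dl) |x|^2 + 2 beta dl, and for small lam a
Gaussian computation gives e^dl E[V(x')] <= V(x) + C dl.  Hence
Q(s, x) = e^s V(x) + C (e^t1 - e^s) is a supermartingale along every chain that
takes Euler-Maruyama steps not longer than h.  Two such chains are used: one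
cuts its last step so as to end at time t, in the continuous interpolant; the
other stops before its first step beyond t, in the piecewise constant
interpolant.  This bounds E[V] uniformly in t, and every moment is dominated by V.

The strong Markov property at the random times t_n is avoided: rounding all
steps down to multiples of 1/(k+1) yields an admissible chain that only sees
deterministic times, and it converges pathwise to the original one.  Nor is
t_n -> oo needed almost surely: on a path where t_n stays bounded, h tends to 0
along the states, so they leave every ball and Q tends to infinity, which
dominates whatever value the interpolants take there.  Both limits are taken by
Fatou's lemma for upper integrals. *)
Require Import Defs.
From HB Require Import structures.
From mathcomp Require Import all_boot all_order all_algebra.
From mathcomp Require Import all_classical all_reals all_analysis.
From mathcomp Require Import measurable_realfun.
From mathcomp Require Import ring lra.

Import Order.TTheory GRing.Theory Num.Theory.
Import numFieldNormedType.Exports.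
Local Open Scope classical_set_scope.
Local Open Scope ring_scope.
Set Implicit Arguments.
Unset Strict Implicit.
Unset Printing Implicit Defensive.

(** * Frobenius and Euclidean norms, and the drift estimate for one step *)

Section euclidean.
Context (R : realType).

Lemma fnorm_ge0 m n (A : 'M[R]_(m, n)) : 0 <= fnorm A.
Proof. exact: sqrtr_ge0. Qed.

Lemma fnorm_sqr m n (A : 'M[R]_(m, n)) :
  fnorm A ^+ 2 = \sum_i \sum_j A i j ^+ 2.
Proof.
rewrite sqr_sqrtr// sumr_ge0// => i _.
by rewrite sumr_ge0// => j _; exact: sqr_ge0.
Qed.

Lemma fnorm_sqr_cV m (x : 'cV[R]_m) : fnorm x ^+ 2 = \sum_i x i 0 ^+ 2.
Proof. by rewrite fnorm_sqr; apply: eq_bigr => i _; rewrite big_ord1. Qed.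

Lemma fnorm_sqr_tr m n (A : 'M[R]_(m, n)) : fnorm A^T ^+ 2 = fnorm A ^+ 2.
Proof.
rewrite !fnorm_sqr exchange_big; apply: eq_bigr => i _.
by apply: eq_bigr => j _; rewrite mxE.
Qed.

Lemma entry_le_fnorm m n (A : 'M[R]_(m, n)) i j : `|A i j| <= fnorm A.
Proof.
rewrite -(ler_pXn2r (ltn0Sn 1)) ?nnegrE ?fnorm_ge0// real_normK ?num_real//.
rewrite fnorm_sqr (bigD1 i)//= (bigD1 j)//= -addrA lerDl.
by rewrite addr_ge0// sumr_ge0// => k _; rewrite ?sqr_ge0// sumr_ge0// => l _;
   rewrite sqr_ge0.
Qed.

(** Lagrange's identity: the double sum of [(a i * b j - a j * b i) ^+ 2] is twice the gap between
    the two sides. *)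
Lemma cauchy_schwarz n (a b : 'I_n -> R) :
  (\sum_i a i * b i) ^+ 2 <= (\sum_i a i ^+ 2) * (\sum_i b i ^+ 2).
Proof.
have : 0 <= \sum_i \sum_j (a i * b j - a j * b i) ^+ 2.
  by rewrite sumr_ge0// => i _; rewrite sumr_ge0// => j _; rewrite sqr_ge0.
have -> : \sum_i \sum_j (a i * b j - a j * b i) ^+ 2 =
    2 * ((\sum_i a i ^+ 2) * (\sum_i b i ^+ 2)) - 2 * (\sum_i a i * b i) ^+ 2.
  have E : (\sum_i a i ^+ 2) * (\sum_i b i ^+ 2) =
      \sum_i \sum_j a i ^+ 2 * b j ^+ 2.
    by rewrite mulr_suml; apply: eq_bigr => i _; rewrite mulr_sumr.
  have E' : (\sum_i a i ^+ 2) * (\sum_i b i ^+ 2) =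
      \sum_i \sum_j a j ^+ 2 * b i ^+ 2 by rewrite E exchange_big.
  have E'' : (\sum_i a i * b i) ^+ 2 =
      \sum_i \sum_j (a i * b i) * (a j * b j).
    by rewrite expr2 mulr_suml; apply: eq_bigr => i _; rewrite mulr_sumr.
  rewrite mulrDl mul1r {1}E E' E'' mulr_sumr -big_split -sumrB.
  apply: eq_bigr => i _; rewrite mulr_sumr -big_split -sumrB.
  apply: eq_bigr => j _ /=; ring.
by rewrite -mulrBr pmulr_rge0 ?ltr0n// subr_ge0.
Qed.

Lemma fnorm_sqr_mulmx m n (A : 'M[R]_(m, n)) (z : 'cV[R]_n) :
  fnorm (A *m z) ^+ 2 <= fnorm A ^+ 2 * fnorm z ^+ 2.
Proof.
rewrite !fnorm_sqr_cV fnorm_sqr mulr_suml; apply: ler_sum => i _.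
by rewrite mxE; exact: cauchy_schwarz.
Qed.

Lemma fnorm_sqrD m (y z : 'cV[R]_m) :
  fnorm (y + z) ^+ 2 = fnorm y ^+ 2 + 2 * dotv y z + fnorm z ^+ 2.
Proof.
rewrite !fnorm_sqr_cV /dotv mulr_sumr -!big_split; apply: eq_bigr => i _ /=.
rewrite mxE; ring.
Qed.

Lemma fnorm_sqrZ m (c : R) (y : 'cV[R]_m) :
  fnorm (c *: y) ^+ 2 = c ^+ 2 * fnorm y ^+ 2.
Proof.
rewrite !fnorm_sqr_cV mulr_sumr; apply: eq_bigr => i _.
by rewrite mxE exprMn.
Qed.

Lemma dotvZr m (c : R) (x y : 'cV[R]_m) : dotv x (c *: y) = c * dotv x y.
Proof.
rewrite /dotv mulr_sumr; apply: eq_bigr => i _; rewrite mxE; ring.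
Qed.

Lemma dotv_mulmx m n (y : 'cV[R]_m) (A : 'M[R]_(m, n)) (z : 'cV[R]_n) :
  dotv y (A *m z) = \sum_i (A^T *m y) i 0 * z i 0.
Proof.
rewrite /dotv; under eq_bigr do rewrite mxE mulr_sumr.
rewrite exchange_big; apply: eq_bigr => j _ /=.
rewrite mxE mulr_suml; apply: eq_bigr => i _.
rewrite mxE; ring.
Qed.

Lemma fnorm_sqr_noise m n (y : 'cV[R]_m) (A : 'M[R]_(m, n)) (z : 'cV[R]_n)
    (beta : R) : fnorm A ^+ 2 <= beta ->
  fnorm (y + A *m z) ^+ 2 <= fnorm y ^+ 2 +
    \sum_i (2 * (A^T *m y) i 0 * z i 0 + beta * z i 0 ^+ 2).
Proof.
move=> Ab; rewrite fnorm_sqrD dotv_mulmx big_split/= -addrA lerD2l.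
apply: lerD; first by rewrite mulr_sumr; apply: ler_sum => i _; rewrite mulrA.
apply: (le_trans (fnorm_sqr_mulmx _ _)).
rewrite -mulr_sumr -fnorm_sqr_cV ler_wpM2r// sqr_ge0//.
Qed.

(** Jensen's inequality for the exponential: [\sum_i u i] is the average of the [n.+1] numbers [0]
    and [n.+1%:R * u i]. The proof sums the tangent-line bounds at that average. *)
Lemma expR_sum_le n (u : 'I_n -> R) :
  expR (\sum_i u i) <= n.+1%:R^-1 * (1 + \sum_i expR (n.+1%:R * u i)).
Proof.
set s := \sum_i u i; rewrite ler_pdivlMl ?ltr0n//.
have tangent v : expR s * (1 + (v - s)) <= expR v.
  rewrite -[v in leRHS](subrKC s) expRD ler_pM2l ?expR_gt0//.
  exact: expR_ge1Dx.
have -> : n.+1%:R * expR s = expR s * (1 + (0 - s)) +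
    \sum_i expR s * (1 + (n.+1%:R * u i - s)).
  rewrite -mulr_sumr -mulrDr mulrC; congr (_ * _).
  rewrite big_split/= sumr_const card_ord big_split/= -mulr_sumr -/s.
  rewrite sumr_const card_ord -[n.+1]addn1 natrD -mulr_natl; ring.
by apply: lerD; [have := tangent 0; rewrite expR0|apply: ler_sum => i _].
Qed.

(** The hypothesis on [h] passes to every shorter step [dl], since the step only multiplies the
    nonnegative [fnorm v ^+ 2]; expanding the square produces [2 * dl] times its left-hand side. *)
Lemma drift_bound m (x v : 'cV[R]_m) (alpha beta h dl : R) :
  dotv x v + 2^-1 * h * fnorm v ^+ 2 <= - alpha * fnorm x ^+ 2 + beta ->
  0 <= dl <= h ->
  fnorm (x + dl *: v) ^+ 2 <=
    fnorm x ^+ 2 - 2 * alpha * dl * fnorm x ^+ 2 + 2 * beta * dl.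
Proof.
move=> hv /andP[d0 dh]; rewrite fnorm_sqrD dotvZr fnorm_sqrZ.
have nv : 0 <= fnorm v ^+ 2 by exact: sqr_ge0.
have : 2^-1 * dl * fnorm v ^+ 2 <= 2^-1 * h * fnorm v ^+ 2.
  by rewrite ler_wpM2r// ler_wpM2l// invr_ge0.
move: (fnorm x ^+ 2) (fnorm v ^+ 2) (dotv x v) nv hv => X V D nv hv hh.
have k : 2 * dl * (D + 2^-1 * dl * V) <= 2 * dl * (- alpha * X + beta).
  by apply: ler_wpM2l; lra.
apply: le_trans (_ : X + 2 * dl * (D + 2^-1 * dl * V) <= _); last lra.
by rewrite le_eqVlt; apply/orP; left; apply/eqP; field.
Qed.

End euclidean.

(** * Entrywise convergence of matrices and sequential continuity *)

Section entrywise_convergence.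
Context (R : realType).

(** Convergence entry by entry gives both convergence in the topology of matrices and convergence in
    [fnorm], the norm in which [f] and [g] are controlled. *)
Definition entry_cvg m n (u : nat -> 'M[R]_(m, n)) (l : 'M[R]_(m, n)) :=
  forall i j, u k i j @[k --> \oo] --> l i j.

Definition seq_continuous m n (phi : 'M[R]_(m, n) -> R) :=
  forall u l, entry_cvg u l -> phi (u k) @[k --> \oo] --> phi l.

Lemma entry_cvg_cvg m n (u : nat -> 'M[R]_(m, n)) l :
  entry_cvg u l -> u k @[k --> \oo] --> l.
Proof.
move=> ul; apply/cvg_ballP => e e0.
have : \forall k \near \oo, forall i j, ball (l i j) e (u k i j).
  apply: filter_forall => i; apply: filter_forall => j.
  by move/cvg_ballP : (ul i j); exact.
by apply: filterS => k uk; split.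
Qed.

Lemma continuous_seq m n (phi : 'M[R]_(m, n) -> R) :
  continuous phi -> seq_continuous phi.
Proof. by move=> cphi u l /entry_cvg_cvg ul; exact: (cvg_comp _ _ ul (cphi l)). Qed.

Lemma cvg_max (u v : nat -> R) a b :
  u k @[k --> \oo] --> a ->
  v k @[k --> \oo] --> b -> Num.max (u k) (v k) @[k --> \oo] --> Num.max a b.
Proof.
move=> ua vb; rewrite maxr_absE; under eq_fun do rewrite maxr_absE.
apply: cvgM; last exact: cvg_cst.
by apply: cvgD; [exact: cvgD|apply: cvg_norm; exact: cvgB].
Qed.

Lemma cvg_min (u v : nat -> R) a b :
  u k @[k --> \oo] --> a ->
  v k @[k --> \oo] --> b -> Num.min (u k) (v k) @[k --> \oo] --> Num.min a b.
Proof.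
move=> ua vb; rewrite minr_absE; under eq_fun do rewrite minr_absE.
apply: cvgM; last exact: cvg_cst.
by apply: cvgB; [exact: cvgD|apply: cvg_norm; exact: cvgB].
Qed.

Lemma cvg_ord_sum n (u : 'I_n -> nat -> R) (l : 'I_n -> R) :
  (forall i, u i k @[k --> \oo] --> l i) ->
  \sum_(i < n) u i k @[k --> \oo] --> \sum_(i < n) l i.
Proof. by move=> ul; apply: cvg_big => //; exact: add_continuous. Qed.

Lemma seq_continuous_fnorm m n : seq_continuous (@fnorm R m n).
Proof.
move=> u l ul; apply: (@cvg_comp _ _ _
    (fun k => \sum_i \sum_j u k i j ^+ 2) Num.sqrt); last exact: sqrt_continuous.
apply: cvg_ord_sum => i; apply: cvg_ord_sum => j.
by rewrite expr2; under eq_fun do rewrite expr2; apply: cvgM.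
Qed.

Lemma entry_cvg_fnorm0 m n (u : nat -> 'M[R]_(m, n)) l :
  entry_cvg u l -> fnorm (u k - l) @[k --> \oo] --> (0 : R).
Proof.
move=> ul; rewrite [0 : R](_ : _ = fnorm (0 : 'M[R]_(m, n))); last first.
  rewrite /fnorm big1 ?sqrtr0// => i _; rewrite big1// => j _.
  by rewrite mxE expr0n.
apply: seq_continuous_fnorm => i j; rewrite mxE -(subrr (l i j)).
have -> : (fun k => (u k - l) i j) = (fun k => u k i j - l i j).
  by apply/funext => k; rewrite !mxE.
by apply: cvgB => //; exact: cvg_cst.
Qed.

Lemma dominated_entry_cvg m n a b (u : nat -> 'M[R]_(m, n)) l
    (v : nat -> 'M[R]_(a, b)) w (C : R) : entry_cvg u l ->
  (\forall k \near \oo, fnorm (v k - w) <= C * fnorm (u k - l)) ->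
  entry_cvg v w.
Proof.
move=> /entry_cvg_fnorm0 ul vC i j.
apply: cvg_sub0 (cvg_cst (w i j)).
apply/norm_cvg0P; apply: (@squeeze_cvgr _ _ _ _ (cst 0)
  (fun k => C * fnorm (u k - l))).
- apply: filterS vC => k vC; rewrite normr_ge0/= (le_trans _ vC)//.
  by have := entry_le_fnorm (v k - w) i j; rewrite !mxE.
- exact: cvg_cst.
- by rewrite -(mulr0 C); apply: cvgM => //; exact: cvg_cst.
Qed.

(** A convergent sequence ends up in the ball of radius [fnorm l + 1], where one Lipschitz constant
    serves [f] and [g] together. *)
Lemma locally_lipschitz_entry_cvg m d (f : 'cV[R]_m -> 'cV[R]_m)
    (g : 'cV[R]_m -> 'M[R]_(m, d)) u l : locally_lipschitz f g ->
  entry_cvg u l -> entry_cvg (f \o u) (f l) /\ entry_cvg (g \o u) (g l).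
Proof.
move=> fg ul.
have l1 : 0 < fnorm l + 1 by rewrite ltr_wpDl ?fnorm_ge0.
have [C fgC] := fg _ l1.
have : \forall k \near \oo, fnorm (u k) <= fnorm l + 1.
  by apply: cvgr_le (seq_continuous_fnorm ul) _ _; rewrite ltrDl.
have ll : fnorm l <= fnorm l + 1 by rewrite lerDl.
move=> H; split; apply: (dominated_entry_cvg (C := C) ul);
  apply: filterS H => k uk; apply: le_trans (fgC _ _ uk ll);
  by rewrite ?lerDl ?lerDr fnorm_ge0.
Qed.

(** The ball lies in a compact cube, on which the continuous positive [h] attains a positive
    minimum. *)
Lemma pos_continuous_bounded_below m (h : 'cV[R]_m -> R) (r : R) :
  continuous h -> (forall x, 0 < h x) ->
  exists2 e, 0 < e & forall x, fnorm x <= r -> e <= h x.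
Proof.
move=> ch h0; have [r0|r0] := ltP r 0.
  exists 1 => // x xr; have := le_lt_trans (le_trans (fnorm_ge0 x) xr) r0.
  by rewrite ltxx.
(* The cube consists of row vectors, the form in which [rV_compact] and [EVT_min_rV] apply;
   transposition carries [h] over. *)
pose A := [set v : 'rV[R]_m | forall i, `[- r, r]%classic (v ord0 i)].
have cA : compact A.
  by apply: (@rV_compact _ _ (fun=> `[- r, r]%classic)) => _; exact: segment_compact.
have A0 : A !=set0.
  by exists 0 => i /=; rewrite mxE in_itv/= oppr_le0 r0.
have ctr : continuous (fun v : 'rV[R]_m => v^T).
  move=> v S /nbhs_ballP[e e0 eS]; apply/nbhs_ballP.
  by exists e => // w [_ vw]; apply: eS; split => // i j; rewrite !mxE.
have [|c _ cmin] := @EVT_min_rV R m (fun v => h v^T) A A0 cA.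
  apply: continuous_subspaceT => v.
  by apply: continuous_comp; [exact: ctr|exact: ch].
exists (h c^T) => // x xr; rewrite -(trmxK x); apply: cmin.
rewrite inE => i /=; rewrite mxE in_itv/= -ler_norml.
exact: le_trans (entry_le_fnorm _ _ _) xr.
Qed.

End entrywise_convergence.

(** * Measurability of sequentially continuous functions of random matrices *)

Section measurable_seq_continuous.
Context d (T : measurableType d) (R : realType).

Definition measurable_entries m n (X : T -> 'M[R]_(m, n)) :=
  forall i j, measurable_fun setT (fun w => X w i j).

Lemma measurable_countable_valued (C : countType) d' (U : measurableType d')
    (z : T -> C) (psi : C -> U) :
  (forall c, measurable (z @^-1` [set c])) -> measurable_fun setT (psi \o z).
Proof.
move=> mz _ B mB; rewrite setTI.
have -> : (psi \o z) @^-1` B =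
    \bigcup_(c : C) (if `[<B (psi c)>] then z @^-1` [set c] else set0).
  apply/seteqP; split => [w Bw|w [c _]].
    by exists (z w) => //; rewrite asboolT.
  by case: ifPn => // /asboolP Bc /= zc; rewrite /preimage/= zc.
apply: countable_bigcupT_measurable => [|c]; first exact: countableP.
by case: ifPn.
Qed.

(* X is approximated by countably-valued maps, each entry being rounded down to
   a multiple of 1 / (k + 1). *)
Lemma measurable_seq_continuous m n (phi : 'M[R]_(m, n) -> R)
    (X : T -> 'M[R]_(m, n)) :
  seq_continuous phi -> measurable_entries X -> measurable_fun setT (phi \o X).
Proof.
move=> cphi mX.
pose z k (w : T) : 'M[int]_(m, n) :=
  \matrix_(i, j) Num.floor (X w i j * k.+1%:R).
pose D k (c : 'M[int]_(m, n)) : 'M[R]_(m, n) :=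
  \matrix_(i, j) ((c i j)%:~R / k.+1%:R).
apply: (@measurable_fun_cvg _ _ _ _ (fun k => (phi \o D k) \o z k)) => [k|w _].
  apply: measurable_countable_valued => c.
  have -> : z k @^-1` [set c] = \bigcap_(p in [set: 'I_m * 'I_n])
      [set w | X w p.1 p.2 * k.+1%:R \in
                 `[(c p.1 p.2)%:~R, (c p.1 p.2 + 1)%:~R[].
    apply/seteqP; split => w /= => [<- [i j] _/=|H].
      by rewrite mxE in_itv/= floor_itv.
    apply/matrixP => i j; rewrite mxE; apply: floor_def.
    by have := H (i, j) I; rewrite /= in_itv.
  apply: fin_bigcap_measurable => [|[i j] _ /=]; first exact: finite_finset.
  rewrite -[X in measurable X]setTI.
  have : measurable_fun setT (fun w => X w i j * k.+1%:R).
    by apply: measurable_funM.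
  by move=> /(_ measurableT _ (measurable_itv `[(c i j)%:~R, (c i j + 1)%:~R[)).
apply: cphi => i j /=.
rewrite /D /z; under eq_fun do rewrite !mxE.
apply: cvg_sub0 (cvg_cst (X w i j)); apply/norm_cvg0P.
apply: (@squeeze_cvgr _ _ _ _ (cst 0) (@harmonic R)); last 2 first.
- exact: cvg_cst.
- exact: cvg_harmonic.
apply: nearW => k; rewrite !fctE normr_ge0/=.
set y := X w i j; have /andP[f1 f2] := floor_itv (y * k.+1%:R).
have k0 : 0 < k.+1%:R :> R by rewrite ltr0n.
rewrite intrD in f2; set F := (Num.floor _)%:~R in f1 f2 *.
have -> : F / k.+1%:R - y = (F - y * k.+1%:R) / k.+1%:R.
  by rewrite mulrBl mulfK// lt0r_neq0.
rewrite normrM (ger0_norm (x := _^-1)) ?invr_ge0//.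
rewrite ler_piMl ?invr_ge0// ler0_norm ?subr_le0// opprB lerBlDl.
by rewrite ltW.
Qed.

End measurable_seq_continuous.

(** * Gaussian integrals of exponentials of quadratics *)

Section gaussian.
Context (R : realType).
Local Notation mu := (@lebesgue_measure R).

(** By uniqueness of densities, the Radon-Nikodym derivative of [normal_prob] equals [normal_pdf]
    almost everywhere. *)
Lemma integral_normal_prob (m s : R) (f : measurableTypeR R -> \bar R) :
  measurable_fun setT f -> (forall x, 0 <= f x)%E ->
  (\int[normal_prob m s]_x f x = \int[mu]_x (f x * (normal_pdf m s x)%:E))%E.
Proof.
move=> mf f0.
rewrite -(Radon_Nikodym_SigmaFinite.change_of_variables
  (normal_prob_dominates m s))//.
have iRN := Radon_Nikodym_SigmaFinite.f_integrable (normal_prob_dominates m s).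
apply: ae_eq_integral => //.
- by apply: emeasurable_funM => //; exact: measurable_int iRN.
- apply: emeasurable_funM => //.
  by apply/measurable_EFinP; exact: measurable_normal_pdf.
- apply: ae_eqe_mul2l; apply: integral_ae_eq => //.
  + by apply/measurable_EFinP; exact: measurable_normal_pdf.
  + move=> E _ mE; rewrite -Radon_Nikodym_SigmaFinite.f_integral//.
    exact: normal_prob_dominates.
Qed.

(* Completing the square: tilting a centred Gaussian density by expR of a
   quadratic gives a multiple of another Gaussian density. *)
Lemma expR_quad_normal_pdf (dl a b x : R) : 0 < dl -> 2 * b * dl < 1 ->
  let dl' := dl / (1 - 2 * b * dl) in
  expR (a * x + b * x ^+ 2) * normal_pdf 0 (Num.sqrt dl) x =
  (Num.sqrt (1 - 2 * b * dl))^-1 * expR (a ^+ 2 * dl' / 2) *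
    normal_pdf (a * dl') (Num.sqrt dl') x.
Proof.
move=> dl0 bdl dl'.
have q0 : 0 < 1 - 2 * b * dl by rewrite subr_gt0.
have dl'0 : 0 < dl' by rewrite divr_gt0.
rewrite !normal_pdfE ?gt_eqF ?sqrtr_gt0// /normal_peak /normal_fun.
rewrite !sqr_sqrtr ?ltW// subr0.
have -> : Num.sqrt (dl' * pi *+ 2) =
    Num.sqrt (dl * pi *+ 2) / Num.sqrt (1 - 2 * b * dl).
  rewrite -sqrtrV ?ltW// -sqrtrM; last first.
    by rewrite mulrn_wge0// mulr_ge0// ?pi_ge0// ltW.
  by congr Num.sqrt; rewrite /dl' [in LHS]mulrAC; exact/esym/mulrnAl.
rewrite invfM invrK mulrCA -expRD.
set q := Num.sqrt (1 - _).
set r := (Num.sqrt (dl * pi *+ 2))^-1.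
set A := expR (_ / 2); set B := expR (- (x - _) ^+ 2 / _).
have -> : q^-1 * A * (r * q * B) = (q^-1 * q) * (r * (A * B)) by ring.
rewrite mulVf ?gt_eqF ?sqrtr_gt0// mul1r -expRD; congr (_ * expR _).
rewrite /dl'; field.
by rewrite !gt_eqF.
Qed.

(** Tilting gives the exact value. Since [2 * b * dl] is at most one half, the tilted variance is at
    most [2 * dl], and the inverse square root in front is at most [expR (2 * b * dl)]. *)
Lemma normal_prob_expR_quad (dl a b : R) : 0 < dl -> 0 <= b ->
  2 * b * dl <= 2^-1 ->
  (\int[normal_prob 0 (Num.sqrt dl)]_x (expR (a * x + b * x ^+ 2))%:E <=
     (expR (2 * b * dl + a ^+ 2 * dl))%:E)%E.
Proof.
move=> dl0 b0 bdl.
have q1 : 2 * b * dl < 1 by rewrite (le_lt_trans bdl)// invf_lt1 ?ltr1n.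
have bdl0 : 0 <= 2 * b * dl by rewrite !mulr_ge0// ltW.
rewrite integral_normal_prob; last 2 first.
- apply/measurable_EFinP/measurableT_comp => //.
  by apply: measurable_funD; apply: measurable_funM => //; exact: measurable_funX.
- by move=> x; rewrite lee_fin expR_ge0.
under eq_integral do rewrite -EFinM expR_quad_normal_pdf// EFinM.
set dl' := dl / _; set c := _ * expR _.
have q0 : 0 < 1 - 2 * b * dl by rewrite subr_gt0.
rewrite ge0_integralZl//; last 3 first.
- by apply/measurable_EFinP; exact: measurable_normal_pdf.
- by move=> x _; rewrite lee_fin normal_pdf_ge0.
- by rewrite lee_fin mulr_ge0 ?invr_ge0 ?sqrtr_ge0 ?expR_ge0.
rewrite integral_normal_pdf mule1 lee_fin expRD.
have le2 : (1 - 2 * b * dl)^-1 <= 2.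
  by rewrite -[_^-1]mul1r ler_pdivrMr//; lra.
apply: ler_pM; rewrite ?invr_ge0 ?sqrtr_ge0 ?expR_ge0//.
- rewrite -sqrtrV; last exact: ltW.
  have -> : expR (2 * b * dl) = Num.sqrt (expR (2 * b * dl) ^+ 2).
    by rewrite sqrtr_sqr ger0_norm ?expR_ge0.
  rewrite ler_wsqrtr//.
  rewrite -expRM_natl -[_^-1]mul1r ler_pdivrMr//.
  (* With [y = 2 * b * dl] between [0] and [1/2], the product is [1 + y * (1 - 2 * y)], hence at
     least [1]. *)
  apply: (@le_trans _ _ ((1 + 2%:R * (2 * b * dl)) * (1 - 2 * b * dl))).
    move: (2 * b * dl) bdl0 bdl => y y0 y1; nra.
  by apply: ler_wpM2r; [exact: ltW|exact: expR_ge1Dx].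
- rewrite ler_expR /dl' !mulrA -(mulrA (a ^+ 2 * dl)) ler_piMr//.
    by rewrite mulr_ge0// ?sqr_ge0// ltW.
  by rewrite ler_pdivrMr// mul1r.
Qed.

End gaussian.

(** * Integrating out a variable independent of a sub-sigma-algebra *)

Section independence.
Context d (T : measurableType d) (R : realType) (P : probability T R).
Variable G : set (set T).
Hypotheses (sG : sigma_algebra setT G) (Gm : G `<=` measurable).
Local Notation TG := (g_sigma_algebraType G).

Lemma measurable_sub_sigma (A : set TG) : measurable A -> measurable (A : set T).
Proof. by rewrite measurable_g_measurableTypeE// => /Gm. Qed.

Lemma measurable_fun_sub_sigma d' (U : measurableType d') (u : T -> U) :
  measurable_fun setT (u : TG -> U) -> measurable_fun setT u.
Proof.
move=> mu _ B mB; apply: measurable_sub_sigma.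
exact: mu.
Qed.

(** The law of [(w, Z w)] on the product of [G] with the Borel sets is a product measure, as it
    agrees with one on rectangles; Tonelli's theorem then integrates [Z] out. Keeping the point [w]
    itself as first coordinate lets [Phi] depend on anything known to [G]. *)
Lemma integral_indep (Z : T -> R) (nu : probability (measurableTypeR R) R)
    (Phi : TG * measurableTypeR R -> \bar R) :
  measurable_fun setT Z ->
  (forall A B, G A -> measurable B ->
     P (A `&` Z @^-1` B) = P A * nu B)%E ->
  measurable_fun setT Phi -> (forall x, 0 <= Phi x)%E ->
  (\int[P]_w Phi (w, Z w) = \int[P]_w \int[nu]_z Phi (w, z))%E.
Proof.
move=> mZ ind mPhi Phi0.
pose phi (w : T) : TG * measurableTypeR R := (w, Z w).
pose idG (w : T) : TG := w.
have midG : measurable_fun setT idG.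
  by move=> _ B mB; rewrite setTI; exact: measurable_sub_sigma.
have mphi : measurable_fun setT phi by exact/measurable_fun_pairP.
pose X1 : {mfun T >-> TG} := HB.pack idG (isMeasurableFun.Build _ _ _ _ _ midG).
pose m1 : probability TG R := distribution P X1.
pose X2 : {mfun T >-> (TG * measurableTypeR R)%type} :=
  HB.pack phi (isMeasurableFun.Build _ _ _ _ _ mphi).
pose m2 : probability _ R := distribution P X2.
transitivity (\int[m2]_x Phi x)%E.
  by rewrite ge0_integral_pushforward.
transitivity (\int[m1 \x nu]_x Phi x)%E.
  apply: eq_measure_integral => /= A mA _; apply/esym.
  apply: product_measure_unique => // B C mB mC.
  rewrite -ind//.
  by move: mB; rewrite measurable_g_measurableTypeE.
rewrite fubini_tonelli1// ge0_integral_pushforward//.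
  exact: measurable_fun_fubini_tonelli_F.
by move=> w _; exact: integral_ge0.
Qed.

(** Given [G], the quantities [u], [a] and the indicator of [A] are constants, so the Gaussian bound
    applies to the inner integral for each [w]. *)
Lemma integral_indep_expR (Z : T -> R) (dl b : R) (u a : T -> R) (A : set T) :
  measurable_fun setT Z ->
  (forall A B, G A -> measurable B ->
     P (A `&` Z @^-1` B) = P A * normal_prob 0 (Num.sqrt dl) B)%E ->
  G A ->
  measurable_fun setT (u : TG -> R) -> measurable_fun setT (a : TG -> R) ->
  0 < dl -> 0 <= b -> 2 * b * dl <= 2^-1 ->
  (\int[P]_(w in A) (expR (u w + (a w * Z w + b * Z w ^+ 2)))%:E <=
   \int[P]_(w in A) (expR (u w + (2 * b * dl + a w ^+ 2 * dl)))%:E)%E.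
Proof.
move=> mZ ind GA mu ma dl0 b0 bdl.
have mA : measurable (A : set TG) by rewrite measurable_g_measurableTypeE.
have mu' := measurable_fun_sub_sigma mu.
have ma' := measurable_fun_sub_sigma ma.
pose Phi (x : TG * measurableTypeR R) : \bar R :=
  ((\1_A x.1 * expR (u x.1))%:E * (expR (a x.1 * x.2 + b * x.2 ^+ 2))%:E)%E.
have Phi0 x : (0 <= Phi x)%E by rewrite mule_ge0// lee_fin ?mulr_ge0// expR_ge0.
have mPhi : measurable_fun setT Phi.
  apply: emeasurable_funM; apply/measurable_EFinP.
    apply: (measurableT_comp (f := fun w : TG => \1_A w * expR (u w))) => //.
    apply: measurable_funM; first exact: measurable_indic.
    exact: measurableT_comp.
  apply: measurableT_comp => //; apply: measurable_funD; apply: measurable_funM => //.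
    exact: (measurableT_comp ma).
  exact: measurable_funX.
rewrite integral_mkcond [leRHS]integral_mkcond.
have -> : (\int[P]_x
    ((fun w => (expR (u w + (a w * Z w + b * Z w ^+ 2)))%:E) \_ A) x =
    \int[P]_w Phi (w, Z w))%E.
  apply: eq_integral => w _; rewrite /Phi patchE indicE/=.
  by case: ifPn => _; rewrite ?mul0r ?mul0e// mul1r -EFinM -expRD.
rewrite (integral_indep mZ ind)//.
apply: ge0_le_integral => //.
- by move=> w _; exact: integral_ge0.
- apply: measurable_fun_sub_sigma.
  exact: measurable_fun_fubini_tonelli_F.
- apply/(measurable_restrictT _ _).1; first exact: Gm.
  apply/measurable_EFinP/measurable_funTS/measurableT_comp => //.
  apply: measurable_funD => //; apply: measurable_funD => //.
  by apply: measurable_funM => //; exact: measurable_funX.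
- move=> w _; rewrite /Phi/= ge0_integralZl//=; last first.
    apply/measurable_EFinP/measurableT_comp => //.
    by apply: measurable_funD; apply: measurable_funM => //; exact: measurable_funX.
  rewrite patchE indicE; case: ifPn => _; last by rewrite mul0r mul0e.
  rewrite mul1r [in leRHS]expRD EFinM lee_wpmul2l ?lee_fin ?expR_ge0//.
  exact: normal_prob_expR_quad.
Qed.

End independence.

(** * The Lyapunov function and its deterministic one-step contraction *)

Section lyapunov.
Context (R : realType).

Definition lyap (lam : R) m (x : 'cV[R]_m) : R := expR (lam * fnorm x ^+ 2).

Lemma lyap_ge0 lam m (x : 'cV[R]_m) : 0 <= lyap lam x.
Proof. exact: expR_ge0. Qed.

Lemma seq_continuous_lyap lam m : seq_continuous (@lyap lam m).
Proof.
move=> u l ul; apply: (@cvg_comp _ _ _ (fun k => lam * fnorm (u k) ^+ 2) expR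
    _ (nbhs (lam * fnorm l ^+ 2))).
  apply: cvgM; first exact: cvg_cst.
  by rewrite expr2; under eq_fun do rewrite expr2; apply: cvgM;
     exact: seq_continuous_fnorm.
exact: continuous_expR.
Qed.

(** The term [2 * beta] comes from the drift, [2 * d.+1%:R * beta] from the Gaussian prefactor, and
    [2 * alpha * beta * hmax] from comparing the norms after and before the drift; the final [1]
    absorbs the weight [expR dl]. *)
Definition lyap_drift (d : nat) (hmax alpha beta lam : R) : R :=
  lam * (2 * beta + 2 * alpha * beta * hmax + 2 * d.+1%:R * beta) + 1.

(** The factor [expR (a / alpha)] bounds the Lyapunov function where dissipation does not dominate;
    [a * expR (a * hmax)] bounds the rate at which [expR (a * dl)] leaves [1]. *)
Definition lyap_const (d : nat) (hmax alpha beta lam : R) : R :=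
  let a := lyap_drift d hmax alpha beta lam in
  expR (a / alpha) * a * expR (a * hmax).

Lemma lyap_drift_gt0 d (hmax alpha beta lam : R) : 0 <= hmax -> 0 <= alpha ->
  0 <= beta -> 0 <= lam -> 0 < lyap_drift d hmax alpha beta lam.
Proof.
by move=> *; rewrite ltr_wpDl// mulr_ge0// !addr_ge0// !mulr_ge0.
Qed.

(** With [u = a * dl], this is [1 - u <= expR (- u)] multiplied by [expR u]. *)
Lemma expR_sub1_le (a h dl : R) : 0 <= a -> dl <= h -> 0 <= dl ->
  expR (a * dl) - 1 <= a * dl * expR (a * h).
Proof.
move=> a0 dlh dl0.
have : expR (a * dl) * (1 + - (a * dl)) <= 1.
  by rewrite -[leRHS](expRxMexpNx_1 (a * dl)) ler_wpM2l ?expR_ge0// expR_ge1Dx.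
have : expR (a * dl) <= expR (a * h) by rewrite ler_expR ler_wpM2l.
have : 0 <= a * dl by rewrite mulr_ge0.
by move: (a * dl) (expR _) (expR (a * h)) => u v w u0 vw h1; nra.
Qed.

(** Here [X] and [Y] stand for the squared norms before and after the drift. Half of the dissipation
    [2 * alpha * dl * X] pays for the quadratic noise term, by the smallness of [lam]; the other
    half survives. *)
Lemma lyap_exponent_le d (hmax alpha beta lam X Y dl : R) :
  0 < alpha -> 0 < beta -> 0 < lam ->
  4 * d.+1%:R ^+ 2 * lam * beta <= alpha ->
  0 <= X -> 0 <= Y -> 0 <= dl <= hmax ->
  Y <= X - 2 * alpha * dl * X + 2 * beta * dl ->
  lam * Y + (2 * (d.+1%:R * lam * beta) * dl +
    4 * d.+1%:R ^+ 2 * lam ^+ 2 * beta * Y * dl) <=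
  lam * X - alpha * dl * (lam * X) +
    (lyap_drift d hmax alpha beta lam - 1) * dl.
Proof.
move=> al0 be0 la0 lamal X0 Y0 /andP[dl0 dlh] YX.
rewrite /lyap_drift addrK; set N : R := d.+1%:R in lamal *.
have YX' : Y <= X + 2 * beta * hmax.
  apply: (le_trans YX); rewrite lerD//; last by rewrite ler_wpM2l// mulr_ge0// ltW.
  by rewrite gerBl !mulr_ge0// ltW.
have h1 : (4 * N ^+ 2 * lam * beta) * (lam * dl * Y) <= alpha * (lam * dl * Y).
  by rewrite ler_wpM2r// !mulr_ge0// ltW.
have h2 : (alpha * lam * dl) * Y <= (alpha * lam * dl) * (X + 2 * beta * hmax).
  by rewrite ler_wpM2l// !mulr_ge0// ltW.
have h3 : lam * Y <= lam * (X - 2 * alpha * dl * X + 2 * beta * dl).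
  by rewrite ler_wpM2l// ltW.
lra.
Qed.

(* Where v >= a / alpha the drift dominates; elsewhere expR v is bounded. *)
Lemma lyap_contraction d (hmax alpha beta lam v dl : R) :
  0 <= hmax -> 0 < alpha -> 0 <= beta -> 0 <= lam -> 0 <= v ->
  0 <= dl <= hmax ->
  expR dl * expR (v - alpha * dl * v +
    (lyap_drift d hmax alpha beta lam - 1) * dl) <=
  expR v + lyap_const d hmax alpha beta lam * dl.
Proof.
move=> h0 al0 be0 la0 v0 /andP[dl0 dlh].
have := lyap_drift_gt0 d h0 (ltW al0) be0 la0.
rewrite /lyap_const; set a := lyap_drift _ _ _ _ _ => a0.
rewrite -expRD; set e := dl + _.
have -> : e = v + (a - alpha * v) * dl by rewrite /e; ring.
have [av|va] := leP a (alpha * v).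
  apply: (@le_trans _ _ (expR v)).
    by rewrite ler_expR gerDl mulr_le0_ge0// subr_le0.
  by rewrite lerDl !mulr_ge0// ?expR_ge0// ltW.
have vb : expR v <= expR (a / alpha).
  by rewrite ler_expR ler_pdivlMr// mulrC ltW.
apply: (@le_trans _ _ (expR v * expR (a * dl))).
  by rewrite -expRD ler_expR lerD2l ler_wpM2r// gerBl mulr_ge0// ltW.
rewrite -lerBlDl -[X in _ - X]mulr1 -mulrBr.
apply: (@le_trans _ _ (expR (a / alpha) * (a * dl * expR (a * hmax)))); last lra.
apply: ler_pM; rewrite ?expR_ge0//.
  by rewrite subr_ge0 -expR0 ler_expR mulr_ge0// ltW.
by apply: expR_sub1_le => //; exact: ltW.
Qed.

End lyapunov.
Arguments lyap {R} lam {m} x.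

Lemma sume_const_ord (R : realType) (x : \bar R) n :
  (\sum_(i < n) x = n%:R%:E * x)%E.
Proof.
elim: n => [|n IH]; first by rewrite big_ord0 mul0e.
by rewrite big_ord_recr/= IH !mule_natl addeC -muleS.
Qed.

(** * Expectation of the Lyapunov function after a Gaussian perturbation *)

Section noise_step.
Context disp (T : measurableType disp) (R : realType) (P : probability T R).
Context (m d : nat) (G : set (set T)).
Hypotheses (sG : sigma_algebra setT G) (Gm : G `<=` measurable).
Local Notation TG := (g_sigma_algebraType G).

Lemma measurable_fnorm_sqr disp' (U : measurableType disp') a b
    (X : U -> 'M[R]_(a, b)) :
  measurable_entries X -> measurable_fun setT (fun w => fnorm (X w) ^+ 2).
Proof.
move=> mX; apply: measurable_funX.
exact: (measurable_seq_continuous (@seq_continuous_fnorm R a b) mX).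
Qed.

Lemma measurable_entries_mulmx disp' (U : measurableType disp') a b c
    (X : U -> 'M[R]_(a, b)) (Y : U -> 'M[R]_(b, c)) :
  measurable_entries X -> measurable_entries Y ->
  measurable_entries (fun w => X w *m Y w).
Proof.
move=> mX mY i j; under eq_fun do rewrite mxE.
by apply: measurable_sum => k; exact: measurable_funM.
Qed.

Lemma measurable_entriesD disp' (U : measurableType disp') a b
    (X Y : U -> 'M[R]_(a, b)) :
  measurable_entries X -> measurable_entries Y ->
  measurable_entries (fun w => X w + Y w).
Proof.
by move=> mX mY i j; under eq_fun do rewrite mxE; exact: measurable_funD.
Qed.

Lemma measurable_entriesZ disp' (U : measurableType disp') a b (c : R)
    (X : U -> 'M[R]_(a, b)) :
  measurable_entries X -> measurable_entries (fun w => c *: X w).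
Proof.
by move=> mX i j; under eq_fun do rewrite mxE; exact: measurable_funM.
Qed.

Lemma measurable_entries_sub_sigma a b (X : T -> 'M[R]_(a, b)) :
  measurable_entries (X : TG -> _) -> measurable_entries X.
Proof. by move=> mX i j; apply: measurable_fun_sub_sigma (mX i j). Qed.

(* The convexity bound expR_sum_le decouples the coordinates of the noise, so
   that only their marginal laws matter, at the price of a factor d + 1 in the
   exponent (d + 1 rather than d, so that d = 0 needs no separate treatment). *)
Lemma integral_lyap_noise (beta lam dl : R) (y : T -> 'cV[R]_m)
    (M : T -> 'M[R]_(m, d)) (Z : T -> 'cV[R]_d) (A : set T) :
  0 < beta -> 0 < lam -> 0 < dl -> 2 * (d.+1%:R * lam * beta) * dl <= 2^-1 ->
  measurable_entries (y : TG -> _) -> measurable_entries (M : TG -> _) ->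
  measurable_entries Z ->
  (forall i A B, G A -> measurable B ->
     P (A `&` (fun w => Z w i 0%R) @^-1` B) =
     P A * normal_prob 0 (Num.sqrt dl) B)%E ->
  G A -> (forall w, fnorm (M w) ^+ 2 <= beta) ->
  (\int[P]_(w in A) (lyap lam (y w + M w *m Z w))%:E <=
   \int[P]_(w in A) (expR (lam * fnorm (y w) ^+ 2 +
     (2 * (d.+1%:R * lam * beta) * dl +
      4 * d.+1%:R ^+ 2 * lam ^+ 2 * beta * fnorm (y w) ^+ 2 * dl)))%:E)%E.
Proof.
move=> be0 la0 dl0 small my mM mZ ind GA Mb.
have mA := Gm GA.
have my' := measurable_entries_sub_sigma my.
have mM' := measurable_entries_sub_sigma mM.
set N : R := d.+1%:R in small *.
have N0 : 0 < N by rewrite ltr0n.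
pose a i w := 2 * N * lam * ((M w)^T *m y w) i 0.
pose b := N * lam * beta.
have b0 : 0 <= b by rewrite !mulr_ge0// ltW.
pose u w := lam * fnorm (y w) ^+ 2.
have mu : measurable_fun setT (u : TG -> R).
  by apply: measurable_funM => //; exact: measurable_fnorm_sqr.
have mu' := measurable_fun_sub_sigma sG Gm mu.
have ma i : measurable_fun setT (a i : TG -> R).
  apply: measurable_funM => //; apply: measurable_entries_mulmx => // k l.
  by under eq_fun do rewrite mxE; exact: mM.
have ma' i := measurable_fun_sub_sigma sG Gm (ma i).
pose e i w := expR (u w + (a i w * Z w i 0 + b * Z w i 0 ^+ 2)).
have me i : measurable_fun setT (e i).
  apply: measurableT_comp => //; apply: measurable_funD => //.
  apply: measurable_funD; apply: measurable_funM => //.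
  by apply: measurable_funX; exact: mZ.
set rhs := (X in (_ <= X)%E).
have mr : measurable_fun setT (fun w => expR (u w + (2 * b * dl +
    4 * N ^+ 2 * lam ^+ 2 * beta * fnorm (y w) ^+ 2 * dl))).
  apply: measurableT_comp => //; apply: measurable_funD => //.
  apply: measurable_funD => //; apply: measurable_funM => //.
  by apply: measurable_funM => //; exact: measurable_fnorm_sqr.
have step i : (\int[P]_(w in A) (e i w)%:E <= rhs)%E.
  have mZi := mZ i 0; have indi := ind i; have mai := ma i.
  apply: (le_trans (integral_indep_expR sG Gm mZi indi GA mu mai dl0 b0 small)).
  apply: ge0_le_integral => //.
  - apply/measurable_EFinP/measurable_funTS/measurableT_comp => //.
    apply: measurable_funD => //; apply: measurable_funD => //.
    by apply: measurable_funM => //; exact: measurable_funX.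
  - exact/measurable_EFinP/measurable_funTS.
  - move=> w _; rewrite lee_fin ler_expR !lerD2l ler_wpM2r ?(ltW dl0)//.
    rewrite /a exprMn [leLHS](_ : _ = 4 * N ^+ 2 * lam ^+ 2 *
      ((M w)^T *m y w) i 0 ^+ 2); last by ring.
    rewrite -[leRHS]mulrA ler_wpM2l ?mulr_ge0 ?sqr_ge0 ?(ltW la0)//.
    have h := entry_le_fnorm ((M w)^T *m y w) i 0.
    rewrite -real_normK ?num_real//.
    apply: (@le_trans _ _ (fnorm ((M w)^T *m y w) ^+ 2)).
      by rewrite ler_pXn2r ?nnegrE ?fnorm_ge0.
    apply: (le_trans (fnorm_sqr_mulmx _ _)).
    by rewrite fnorm_sqr_tr ler_wpM2r ?sqr_ge0.
(* This handles the summand [1] of [expR_sum_le]. With the [d] coordinates it makes [N] integrals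
   bounded by [rhs], which the factor [N^-1] averages. *)
have step0 : (\int[P]_(w in A) (expR (u w))%:E <= rhs)%E.
  apply: ge0_le_integral => //.
  - by apply/measurable_EFinP/measurable_funTS/measurableT_comp.
  - exact/measurable_EFinP/measurable_funTS.
  - move=> w _; rewrite lee_fin ler_expR lerDl.
    by rewrite addr_ge0// ?mulr_ge0 ?sqr_ge0 ?(ltW N0) ?(ltW la0) ?(ltW dl0)
      ?(ltW be0) ?fnorm_ge0.
pose sm w : \bar R := ((expR (u w))%:E + \sum_(i < d) (e i w)%:E)%E.
have sm0 w : (0 <= sm w)%E.
  by rewrite adde_ge0// sume_ge0// => i _; rewrite lee_fin expR_ge0.
have msm : measurable_fun setT sm.
  apply: emeasurable_funD; first exact/measurable_EFinP/measurableT_comp.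
  by apply: emeasurable_sum => i; exact/measurable_EFinP.
apply: (@le_trans _ _ (\int[P]_(w in A) (N^-1%:E * sm w))%E).
  apply: ge0_le_integral => //.
  - by move=> w _; rewrite lee_fin lyap_ge0.
  - apply/measurable_EFinP/measurable_funTS.
    apply: (measurable_seq_continuous (@seq_continuous_lyap R lam m)).
    by apply: measurable_entriesD => //; exact: measurable_entries_mulmx.
  - by apply: measurable_funTS; exact: emeasurable_funM.
  - move=> w _; rewrite /sm sumEFin -EFinD -EFinM lee_fin /lyap.
    apply: (@le_trans _ _ (expR (u w) *
      expR (\sum_i lam * (2 * ((M w)^T *m y w) i 0 * Z w i 0 + beta * Z w i 0 ^+ 2)))).
      rewrite -expRD ler_expR -mulr_sumr -mulrDr ler_wpM2l ?(ltW la0)//.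
      exact: fnorm_sqr_noise.
    apply: (le_trans (ler_wpM2l (expR_ge0 _) (expR_sum_le _))).
    rewrite mulrCA ler_wpM2l ?invr_ge0 ?(ltW N0)// mulrDr mulr1 lerD2l mulr_sumr.
    rewrite le_eqVlt; apply/orP; left; apply/eqP; apply: eq_bigr => i _.
    rewrite -expRD /e /a /b; congr expR; ring.
rewrite ge0_integralZl//; last 2 first.
- exact: measurable_funTS.
- by rewrite lee_fin invr_ge0 ltW.
rewrite ge0_integralD//; last 3 first.
- by apply/measurable_EFinP/measurable_funTS/measurableT_comp.
- by move=> w _; rewrite sume_ge0// => i _; rewrite lee_fin expR_ge0.
- by apply: measurable_funTS; apply: emeasurable_sum => i; exact/measurable_EFinP.
rewrite ge0_integral_sum//; last 2 first.
- by move=> i; apply: measurable_funTS; exact/measurable_EFinP.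
- by move=> i w _; rewrite lee_fin expR_ge0.
rewrite lee_pdivrMl//.
apply: (@le_trans _ _ (rhs + \sum_(i < d) rhs)%E).
  by apply: leeD => //; apply: lee_sum => i _; exact: step.
by rewrite sume_const_ord /N !mule_natl -muleS.
Qed.

End noise_step.

(** * Measurability, independence and marginal laws of Brownian increments *)

Section brownian_increments.
Context disp (T : measurableType disp) (R : realType) (P : probability T R).
Context (F : R -> set (set T)) (d : nat) (W : R -> T -> 'cV[R]_d).
Hypotheses (FF : filtration F) (BW : brownian_motion P F W).

Lemma measurable_entries_sigmaS (G G' : set (set T)) m n
    (X : T -> 'M[R]_(m, n)) :
  sigma_algebra setT G -> sigma_algebra setT G' -> G `<=` G' ->
  measurable_entries (X : g_sigma_algebraType G -> _) ->
  measurable_entries (X : g_sigma_algebraType G' -> _).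
Proof.
move=> sG sG' GG' mX i j _ B mB.
rewrite measurable_g_measurableTypeE//; apply: GG'.
by have := mX i j measurableT B mB; rewrite measurable_g_measurableTypeE.
Qed.

Lemma brownian_adapted t : 0 <= t ->
  measurable_entries (W t : g_sigma_algebraType (F t) -> _).
Proof.
move=> t0 i j _ B mB; case: FF => sF _ _.
rewrite measurable_g_measurableTypeE ?setTI; last exact: sF.
by case: BW => aW _ _ _ _; rewrite (ord1 j); exact: aW.
Qed.

Lemma measurable_increment s t : 0 <= s -> s <= t ->
  measurable_entries (fun w => W t w - W s w).
Proof.
move=> s0 st i j; have t0 := le_trans s0 st; case: FF => sF mF _.
have mW u : 0 <= u -> measurable_entries (W u).
  move=> u0; apply: measurable_entries_sub_sigma (brownian_adapted u0).
    exact: sF.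
  exact: mF.
rewrite (_ : (fun w => _) = (fun w => W t w i j - W s w i j)).
  by apply: measurable_funB; exact: mW.
by apply/funext => w; rewrite !mxE.
Qed.

(** The marginal law follows from the joint one by taking [setT] in every coordinate other than [i];
    independence applies because an event on one coordinate is a generator of the sigma-algebra of
    the whole increment. *)
Lemma increment_indep s t i (A : set T) (B : set R) : 0 <= s -> s < t ->
  F s A -> measurable B ->
  P (A `&` (fun w => (W t w - W s w) i 0%R) @^-1` B) =
  (P A * normal_prob 0 (Num.sqrt (t - s)) B)%E.
Proof.
move=> s0 st FA mB; case: BW => _ _ _ indW lawW.
have -> : (fun w => (W t w - W s w) i 0) = (fun w => W t w i 0 - W s w i 0).
  by apply/funext => w; rewrite !mxE.
rewrite (indW s t)//.
  pose B' (k : 'I_d) := if k == i then B else setT.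
  have := lawW s t s0 st B' _.
  rewrite (bigD1 i)//= big1 => [|k /negPf ki]; last first.
    by rewrite /B' ki probability_setT.
  rewrite /B' eqxx mule1 => <-; last by move=> k; case: ifP.
  congr (P A * P _)%E; apply/seteqP; split => w /= => [Bw k|/(_ i)].
    by case: eqP => // ->.
  by rewrite eqxx.
apply: sub_sigma_algebra.
suff H : preimage_set_system setT (fun w => W t w i 0 - W s w i 0) measurable
    `<=` \big[setU/set0]_(k < d) preimage_set_system setT
           (fun w => W t w k 0 - W s w k 0) measurable.
  by apply: H; exists B => //; rewrite setTI.
by rewrite (bigD1 i)//=; exact: subsetUl.
Qed.

End brownian_increments.

(** * Upper integrals and Fatou's lemma for them *)

Section upper_mean.
Context d (T : measurableType d) (R : realType) (P : probability T R).
Local Open Scope ereal_scope.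

(** The integral of a nonnegative function is a supremum over the simple functions below it, hence
    monotone without measurability. It serves for the interpolants, whose measurability is never
    established. *)
Lemma ge0_le_integral_nonmeasurable (mu : {measure set T -> \bar R})
    (F G : T -> \bar R) :
  (forall w, 0 <= F w) -> (forall w, F w <= G w) ->
  \int[mu]_w F w <= \int[mu]_w G w.
Proof.
move=> F0 FG; rewrite !ge0_integralTE//; last first.
  by move=> w; exact: le_trans (FG w).
apply: le_ereal_sup => _ [u /= uF <-]; exists u => // w.
exact: le_trans (FG w).
Qed.

(* The upper integral of Y is at most c: unlike the integral itself, this is
   stable under Fatou without any measurability of Y. *)
Definition upper_mean_le (Y : T -> R) (c : R) :=
  exists G : T -> \bar R, [/\ measurable_fun setT G, forall w, 0 <= G w,
    forall w, (Y w)%:E <= G w & \int[P]_w G w <= c%:E].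

Lemma limn_einf_ge (u : (\bar R)^nat) (x : \bar R) :
  (\forall k \near \oo, x <= u k) -> x <= limn_einf u.
Proof.
move=> [N _ xu]; apply: (@le_trans _ _ (einfs u N)).
  by apply: le_ereal_inf_tmp => _ [k /= Nk <-]; exact: xu.
rewrite limn_einf_lim; apply: lime_ge; first exact: is_cvg_einfs.
by exists N => // k /= Nk; exact: nondecreasing_einfs.
Qed.

Lemma limn_einf_le_const (u : (\bar R)^nat) (x : \bar R) :
  (forall k, u k <= x) -> limn_einf u <= x.
Proof.
move=> ux; rewrite limn_einf_lim; apply: lime_le; first exact: is_cvg_einfs.
apply: nearW => k; apply: le_trans (ux k).
by apply: ereal_inf_lbound; exists k => /=.
Qed.

(** The majorant is the lower limit of the majorants of the [Y k]. The second hypothesis says that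
    [Z] is at most the lower limit of the [Y k], and so allows [Y k w] to tend to infinity. *)
Lemma upper_mean_fatou (Y : nat -> T -> R) (Z : T -> R) (c : R) :
  (forall k, upper_mean_le (Y k) c) ->
  (forall w y, (y < Z w)%R -> \forall k \near \oo, (y <= Y k w)%R) ->
  upper_mean_le Z c.
Proof.
move=> /choice[G HG] YZ.
exists (fun w => limn_einf (G ^~ w)); split.
- apply: (emeasurable_fun_cvg (fun n w => einfs (G ^~ w) n)) => [n|w _].
    by apply: measurable_fun_einfs => k; case: (HG k).
  by rewrite limn_einf_lim; exact: is_cvg_einfs.
- by move=> w; apply: limn_einf_ge; apply: nearW => k; case: (HG k).
- move=> w; apply/lee_addgt0Pr => e e0; rewrite -leeBlDr//.
  apply: limn_einf_ge.
  have Ze : (Z w - e < Z w)%R by rewrite ltrBlDr ltrDl.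
  apply: filterS (YZ w _ Ze) => k yk; case: (HG k) => _ _ YG _.
  by apply: le_trans (YG w); rewrite -EFinB lee_fin.
- apply: (@le_trans _ _ (limn_einf (fun k => \int[P]_w G k w))).
    by apply: fatou => // k; case: (HG k).
  by apply: limn_einf_le_const => k; case: (HG k).
Qed.

Lemma upper_mean_cvg (Y : nat -> T -> R) (Z : T -> R) (c : R) :
  (forall k, upper_mean_le (Y k) c) ->
  (forall w, Y k w @[k --> \oo] --> Z w) ->
  upper_mean_le Z c.
Proof.
move=> Yc YZ; apply: upper_mean_fatou Yc _ => w y yZ.
exact: cvgr_ge (YZ w) _ yZ.
Qed.

Lemma expectation_upper_mean (Y Z : T -> R) (a c : R) :
  (0 <= a)%R -> upper_mean_le Y c -> (forall w, 0 <= Z w <= a * Y w)%R ->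
  'E_P[Z] <= (a * c)%:E.
Proof.
move=> a0 [G [mG G0 YG Gc]] ZY; rewrite unlock.
apply: (@le_trans _ _ (\int[P]_w (a%:E * G w))).
  apply: ge0_le_integral_nonmeasurable => w.
    by rewrite lee_fin; case/andP: (ZY w).
  apply: (@le_trans _ _ (a * Y w)%:E).
    by rewrite lee_fin; case/andP: (ZY w).
  by rewrite EFinM lee_wpmul2l.
rewrite ge0_integralZl// EFinM lee_wpmul2l//.
Qed.

End upper_mean.

(** * Euler-Maruyama chains with a general step rule, and their rounding to a grid *)

Section em_chain.
Context disp (T : measurableType disp) (R : realType) (m d : nat).
Context (W : R -> T -> 'cV[R]_d).
Context (f : 'cV[R]_m -> 'cV[R]_m) (g : 'cV[R]_m -> 'M[R]_(m, d)).
Definition em_move (s t : R) (x : 'cV[R]_m) (w : T) : 'cV[R]_m :=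
  x + (t - s) *: f x + g x *m (W t w - W s w).

(** The rule [th] sees the time as well as the state, so that capped, frozen, soft and rounded steps
    are all instances. *)
Definition em_step (th : R -> 'cV[R]_m -> R) (w : T) (p : R * 'cV[R]_m) :=
  (p.1 + th p.1 p.2, em_move p.1 (p.1 + th p.1 p.2) p.2 w).

Definition floor_mesh (k : nat) (s : R) : R :=
  (Num.truncn (s * k.+1%:R))%:R / k.+1%:R.

(** It is the arrival time that is rounded down, so that every step lands on the grid. From a time
    off the grid the step may be negative. *)
Definition floor_step k (th : R -> 'cV[R]_m -> R) s x :=
  floor_mesh k (s + th s x) - s.

Lemma floor_mesh_le k s : 0 <= s -> floor_mesh k s <= s.
Proof.
move=> s0; rewrite ler_pdivrMr ?ltr0n//.
by rewrite truncn_le mulr_ge0.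
Qed.

Lemma floor_mesh_gt k (s : R) : s - k.+1%:R^-1 < floor_mesh k s.
Proof.
have k0 : 0 < k.+1%:R :> R by rewrite ltr0n.
rewrite /floor_mesh ltrBlDr -[X in _ + X]mul1r -mulrDl ltr_pdivlMr//.
by rewrite natr1; exact: truncnS_gt.
Qed.

Lemma floor_mesh_ge0 k (s : R) : 0 <= floor_mesh k s.
Proof. by rewrite divr_ge0. Qed.

Hypothesis fg_lip : locally_lipschitz f g.
Hypothesis W_cont : forall w, {within [set t : R | 0 <= t], continuous (W ^~ w)}.

Lemma path_entry_cvg w (ss : nat -> R) (s : R) : (forall k, 0 <= ss k) -> 0 <= s ->
  ss k @[k --> \oo] --> s -> entry_cvg (fun k => W (ss k) w) (W s w).
Proof.
move=> ss0 s0 sss i j.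
have /subspace_continuousP/(_ s s0) Ws := @W_cont w.
have : ss k @[k --> \oo] --> within [set t : R | 0 <= t] (nbhs s).
  move=> A nA; have [N _ HN] := sss _ nA.
  by exists N => // k /= Nk; exact: (HN k Nk (ss0 k)).
move=> /(cvg_comp _ _)/(_ Ws) => sW.
apply/cvg_ballP => e e0; move/cvg_ballP : sW => /(_ e e0).
by apply: filterS => k [_]; exact.
Qed.

Lemma em_move_entry_cvg w (ss tt : nat -> R) (s t : R) (xs : nat -> 'cV[R]_m) x :
  (forall k, 0 <= ss k) -> 0 <= s -> ss k @[k --> \oo] --> s ->
  (forall k, 0 <= tt k) -> 0 <= t -> tt k @[k --> \oo] --> t ->
  entry_cvg xs x ->
  entry_cvg (fun k => em_move (ss k) (tt k) (xs k) w)
    (em_move s t x w).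
Proof.
move=> ss0 s0 sss tt0 t0 ttt xsx i j.
have Wss : entry_cvg (fun k => W (ss k) w) (W s w) := path_entry_cvg ss0 s0 sss.
have Wtt : entry_cvg (fun k => W (tt k) w) (W t w) := path_entry_cvg tt0 t0 ttt.
have [fx gx] := locally_lipschitz_entry_cvg fg_lip xsx.
have emE (s' t' : R) (y : 'cV[R]_m) : em_move s' t' y w i j = y i j +
    (t' - s') * f y i j + \sum_k g y i k * (W t' w k j - W s' w k j).
  by rewrite !mxE; congr (_ + _); apply: eq_bigr => k _; rewrite !mxE.
rewrite emE; under eq_fun do rewrite emE.
apply: cvgD; first apply: cvgD; first exact: xsx.
  by apply: cvgM; [exact: cvgB|exact: fx].
apply: cvg_ord_sum => k; apply: cvgM; first exact: gx.
by apply: cvgB; [exact: Wtt|exact: Wss].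
Qed.

(** Induction on [n]. The rules are assumed to converge along converging times and states, because
    rule, time and state all vary with [k]. Times stay nonnegative, where the paths are
    continuous. *)
Lemma iter_em_step_cvg w (ths : nat -> R -> 'cV[R]_m -> R) th x0 n :
  (forall k s x, 0 <= s -> 0 <= s + ths k s x) ->
  (forall s x, 0 <= s -> 0 <= s + th s x) ->
  (forall ss (s : R) xs x, (forall k, 0 <= ss k) -> 0 <= s ->
    ss k @[k --> \oo] --> s -> entry_cvg xs x ->
    ths k (ss k) (xs k) @[k --> \oo] --> th s x) ->
  let p k := iter n (em_step (ths k) w) (0, x0) in
  let q := iter n (em_step th w) (0, x0) in
  [/\ forall k, 0 <= (p k).1, 0 <= q.1, (p k).1 @[k --> \oo] --> q.1 &
      entry_cvg (fun k => (p k).2) q.2].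
Proof.
move=> ths0 th0 thsth; elim: n => [|n [p0 q0 pq1 pq2]].
  by split => //=; [exact: cvg_cst|move=> i j; exact: cvg_cst].
rewrite /=; split => /=.
- by move=> k; exact: ths0.
- exact: th0.
- by apply: cvgD => //; exact: thsth.
- apply: em_move_entry_cvg => //.
  + by move=> k; exact: ths0.
  + exact: th0.
  + by apply: cvgD => //; exact: thsth.
Qed.

Definition joint_continuous (th : R -> 'cV[R]_m -> R) :=
  forall ss (s : R) xs x, ss k @[k --> \oo] --> s -> entry_cvg xs x ->
    th (ss k) (xs k) @[k --> \oo] --> th s x.

Lemma floor_step_cvg th ss (s : R) xs x :
  (forall s x, 0 <= s -> 0 <= th s x) -> joint_continuous th ->
  (forall k, 0 <= ss k) -> ss k @[k --> \oo] --> s -> entry_cvg xs x ->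
  floor_step k th (ss k) (xs k) @[k --> \oo] --> th s x.
Proof.
move=> th0 thc ss0 sss xsx; have tht := thc _ _ _ _ sss xsx.
apply: (@squeeze_cvgr _ _ _ _ (fun k => th (ss k) (xs k) - @harmonic R k)
  (fun k => th (ss k) (xs k))); last 2 first.
- by rewrite -[X in _ --> X]subr0; apply: cvgB => //; exact: cvg_harmonic.
- by [].
apply: nearW => k; rewrite /floor_step; apply/andP; split.
  rewrite lerBrDr addrAC [X in X - _]addrC; apply/ltW; exact: floor_mesh_gt.
by rewrite lerBlDl floor_mesh_le// addr_ge0// th0.
Qed.

End em_chain.

(** * Step rules that stop at time [t] *)

Section stopped_steps.
Context (R : realType) (m : nat) (h : 'cV[R]_m -> R) (t : R).

(** The last step is shortened so as to end at [t]; the maximum with [0] makes the chain rest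
    afterwards. *)
Definition capped_step (s : R) (x : 'cV[R]_m) := Num.min (h x) (Num.max 0 (t - s)).

(* The frozen step below is discontinuous, but the convergence of the grid
   chains needs a continuous step; as e tends to 0 the soft step becomes equal
   to the frozen one at each fixed point. *)
Definition soft_step (e s : R) (x : 'cV[R]_m) :=
  h x * Num.min 1 (Num.max 0 ((t + e - s - h x) / e)).

Definition frozen_step (s : R) (x : 'cV[R]_m) := if s + h x <= t then h x else 0.

(** If the full step fits before [t], the quotient in [soft_step] is at least [1] for every [e];
    otherwise it is nonpositive once [e] is below the overshoot. *)
Lemma soft_step_eventually s x :
  \forall j \near \oo, soft_step j.+1%:R^-1 s x = frozen_step s x.
Proof.
rewrite /frozen_step; have [st|st] := leP (s + h x) t.
  apply: nearW => j; rewrite /soft_step.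
  have : 0 < j.+1%:R^-1 :> R by rewrite invr_gt0.
  move: (j.+1%:R^-1 : R) => e e0.
  have le1 : 1 <= (t + e - s - h x) / e by rewrite ler_pdivlMr// mul1r; lra.
  by rewrite max_r ?(le_trans ler01)// min_l// mulr1.
have /(@cvgr_lt _ _ \oo _ (@harmonic R) 0 (@cvg_harmonic R)) : 0 < s + h x - t.
  by rewrite subr_gt0.
apply: filterS => j je; rewrite /soft_step max_l ?min_r ?mulr0//.
rewrite pmulr_lle0 ?invr_gt0 ?invr_gt0//.
have {je} : j.+1%:R^-1 < s + h x - t := je.
by move: (j.+1%:R^-1 : R) => e; lra.
Qed.

End stopped_steps.

(** * The stopped chains along one path of the scheme *)

Section em_path.
Context disp (T : measurableType disp) (R : realType) (m d : nat).
Context (W : R -> T -> 'cV[R]_d).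
Context (f : 'cV[R]_m -> 'cV[R]_m) (g : 'cV[R]_m -> 'M[R]_(m, d)).
Context (h : 'cV[R]_m -> R) (hmax : R) (x0 : 'cV[R]_m).
Hypothesis h_bound : forall x, 0 < h x <= hmax.
Hypothesis h_cont : continuous h.
Context (t : R) (w : T).

Let tn n := em_time f g h x0 (W ^~ w) n.
Let xn n := em_state f g h x0 (W ^~ w) n.
Let chain th n := iter n (em_step W f g th w) (0, x0).

Lemma emS n : (tn n.+1, xn n.+1) =
  (tn n + h (xn n), em_move W f g (tn n) (tn n + h (xn n)) (xn n) w).
Proof.
rewrite /tn /xn /em_time /em_state /=; case: (em _ _ _ _ _ n) => s x /=.
rewrite /em_move; have -> : s + h x - s = h x by rewrite addrAC subrr add0r.
by [].
Qed.

Lemma em_timeS n : tn n.+1 = tn n + h (xn n).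
Proof. by have [] := emS n. Qed.

Lemma em_time_lt n : tn n < tn n.+1.
Proof. by rewrite em_timeS ltrDl; have /andP[] := h_bound (xn n). Qed.

Lemma em_time_nondecreasing : nondecreasing_seq tn.
Proof. by apply/nondecreasing_seqP => n; exact/ltW/em_time_lt. Qed.

Lemma em_time_ge0 n : 0 <= tn n.
Proof. exact: (em_time_nondecreasing (leq0n n)). Qed.

Lemma chain_em th n :
  (forall k, (k < n)%N -> th (tn k) (xn k) = h (xn k)) -> chain th n = (tn n, xn n).
Proof.
elim: n => [//|n IH] thE; rewrite /chain iterS -/(chain th n) IH; last first.
  by move=> k kn; apply: thE; exact: ltnW.
by rewrite /em_step /= thE// emS.
Qed.

Lemma chain_capped n : tn n <= t -> chain (capped_step h t) n = (tn n, xn n).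
Proof.
move=> tnt; apply: chain_em => k kn.
have := le_trans (em_time_nondecreasing kn) tnt; rewrite em_timeS => kt.
have hk : h (xn k) <= t - tn k by rewrite lerBrDl.
have /andP[hk0 _] := h_bound (xn k).
rewrite /capped_step min_l// le_max; apply/orP; right; exact: hk.
Qed.

Lemma chain_frozen n : tn n <= t -> chain (frozen_step h t) n = (tn n, xn n).
Proof.
move=> tnt; apply: chain_em => k kn.
have := le_trans (em_time_nondecreasing kn) tnt; rewrite em_timeS => kt.
by rewrite /frozen_step kt.
Qed.

(** The step from index [n] is cut to [t - tn n], whence the index [n.+1]; all later steps vanish,
    and the chain rests at the continuous interpolant. *)
Lemma chain_capped_after n k : tn n <= t -> t < tn n.+1 ->
  chain (capped_step h t) (k + n.+1) = (t, em_move W f g (tn n) t (xn n) w).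
Proof.
move=> tnt ttn; elim: k => [|k IH].
  rewrite add0n /chain iterS -/(chain _ n) chain_capped// /em_step /=.
  have -> : capped_step h t (tn n) (xn n) = t - tn n.
    rewrite /capped_step max_r ?subr_ge0// min_r//.
    by rewrite lerBlDl ltW// -em_timeS.
  by rewrite subrKC.
rewrite addSn /chain iterS -/(chain _ (k + n.+1)) IH /em_step /=.
have -> : forall x, capped_step h t t x = 0.
  move=> x; rewrite /capped_step subrr max_l// min_r//.
  by have /andP[/ltW] := h_bound x.
by rewrite addr0 /em_move !subrr scale0r mulmx0 !addr0.
Qed.

Lemma chain_frozen_after n k : tn n <= t -> t < tn n.+1 ->
  chain (frozen_step h t) (k + n) = (tn n, xn n).
Proof.
move=> tnt ttn; elim: k => [|k IH]; first exact: chain_frozen.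
rewrite addSn /chain iterS -/(chain _ (k + n)) IH /em_step /=.
rewrite /frozen_step -em_timeS leNgt ttn/=.
by rewrite addr0 /em_move !subrr scale0r mulmx0 !addr0.
Qed.

Lemma em_indexP : 0 <= t ->
  let n := em_index f g h x0 (W ^~ w) t in
  (tn n <= t /\ t < tn n.+1) \/ (forall k, tn k <= t).
Proof.
move=> t0 n; have [allt|] := pselect (forall k, tn k <= t); first by right.
move=> /existsNP[k0 /negP]; rewrite -ltNge => k0t; left.
have ex : exists k, t < tn k by exists k0.
have [k tk kmin] := ex_minnP ex.
have k_gt0 : (0 < k)%N.
  by rewrite lt0n; apply/eqP => k0'; move: tk; rewrite k0' ltNge t0.
have : tn n <= t /\ forall j, tn j <= t -> tn j <= tn n.
  apply: (@getPex _ [set i | tn i <= t /\ forall j, tn j <= t -> tn j <= tn i]).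
  exists k.-1; split.
    by rewrite leNgt; apply/negP => /kmin; rewrite leqNgt prednK// leqnn.
  move=> j jt; apply: em_time_nondecreasing.
  rewrite -ltnS prednK// ltnNge; apply/negP => /em_time_nondecreasing kj.
  by have := lt_le_trans tk (le_trans kj jt); rewrite ltxx.
move=> [nt nmax]; split => //; rewrite ltNge; apply/negP => /nmax.
by rewrite leNgt em_time_lt.
Qed.

(* If the grid accumulates before t then h vanishes along it, and since h is
   bounded below on balls the states escape to infinity. *)
Lemma em_state_escape : (forall k, tn k <= t) ->
  forall r : R, \forall k \near \oo, r < fnorm (xn k).
Proof.
move=> tt r; have h0 x : 0 < h x by have /andP[] := h_bound x.
have [e e0 eh] := pos_continuous_bounded_below r h_cont h0.
have /cvg_ex[/= l tnl] : cvgn tn.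
  apply: nondecreasing_is_cvgn; first exact: em_time_nondecreasing.
  by exists t => _ [k _ <-].
have : h (xn k) @[k --> \oo] --> 0.
  rewrite -(subrr l).
  rewrite (_ : (fun k => h (xn k)) = (fun k => tn k.+1 - tn k)).
    by apply: cvgB => //; rewrite cvg_shiftS.
  by apply/funext => k; rewrite em_timeS addrAC subrr add0r.
move=> /cvgr_lt/(_ _ e0); apply: filterS => k hk.
by rewrite ltNge; apply/negP => /eh; rewrite leNgt hk.
Qed.

End em_path.

(** * Growth of the Lyapunov function *)

Lemma lyap_ge_eventually (R : realType) m (lam : R) (x : nat -> 'cV[R]_m) (y : R) :
  0 < lam -> (forall r : R, \forall k \near \oo, r < fnorm (x k)) ->
  \forall k \near \oo, y <= lyap lam (x k).
Proof.
(* Beyond this threshold the norm is at least [1] and at least the absolute value of [y] over [lam],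
   so [lam] times its square dominates [y]. *)
move=> l0 /(_ (1 + `|y| / lam)); apply: filterS => k xk.
have y0 : 0 <= `|y| / lam by rewrite divr_ge0// ltW.
have x1 : 1 <= fnorm (x k) by apply: le_trans (ltW xk); rewrite lerDl.
have xy : `|y| / lam <= fnorm (x k) by apply: le_trans (ltW xk); rewrite lerDr.
apply: le_trans (expR_ge1Dx _); apply: (@le_trans _ _ `|y|); first exact: ler_norm.
apply: (@le_trans _ _ (lam * fnorm (x k) ^+ 2)); last by rewrite lerDr.
rewrite -ler_pdivrMl// mulrC; apply: (le_trans xy).
by rewrite expr2 ler_peMr// fnorm_ge0.
Qed.

(** The logarithm of the power is at most [p * a], and the right-hand exponent exceeds [p * a] by
    the square [lam * (a - p / (2 * lam)) ^+ 2]. *)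
Lemma powR_le_lyap (R : realType) m (lam p : R) (x : 'cV[R]_m) :
  0 < lam -> 0 < p ->
  fnorm x `^ p <= expR (p ^+ 2 / (4 * lam)) * lyap lam x.
Proof.
move=> l0 p0; rewrite /lyap -expRD; have := fnorm_ge0 x.
move: (fnorm x) => a; rewrite le_eqVlt => /predU1P[<-|a0].
  by rewrite powR0 ?gt_eqF// expR_ge0.
rewrite /powR gt_eqF// ler_expR.
apply: (@le_trans _ _ (p * a)); first by rewrite ler_pM2l// ltW// ln_sublinear.
rewrite -subr_ge0.
have -> : p ^+ 2 / (4 * lam) + lam * a ^+ 2 - p * a =
    lam * (a - p / (2 * lam)) ^+ 2 by field; rewrite gt_eqF.
by rewrite mulr_ge0 ?sqr_ge0// ltW.
Qed.

Lemma integral_mul_indic_sub d (T : measurableType d) (R : realType)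
    (P : {measure set T -> \bar R}) (A B : set T) (u : T -> \bar R) : B `<=` A ->
  (\int[P]_(w in B) u w = \int[P]_(w in A) (u w * (\1_B w)%:E))%E.
Proof.
move=> BA; rewrite integral_mkcond [RHS]integral_mkcond; apply: eq_integral => w _.
rewrite !patchE indicE; have [wB|wB] := boolP (w \in B).
  have -> : w \in A by rewrite inE; apply: BA; rewrite inE in wB.
  by rewrite mule1.
by rewrite mule0; case: ifP.
Qed.

(** * The one-step inequality and the supermartingale along grid chains *)

Section em_moments.
Context disp (T : measurableType disp) (R : realType) (P : probability T R).
Context (F : R -> set (set T)) (m d : nat) (W : R -> T -> 'cV[R]_d).
Hypotheses (FF : filtration F) (BW : brownian_motion P F W).
Context (f : 'cV[R]_m -> 'cV[R]_m) (g : 'cV[R]_m -> 'M[R]_(m, d)).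
Context (h : 'cV[R]_m -> R) (hmax alpha beta lam : R).
Hypotheses (alpha_gt0 : 0 < alpha) (beta_gt0 : 0 < beta) (lam_gt0 : 0 < lam).
Hypothesis lam_small : 2 * (d.+1%:R * lam * beta) * hmax <= 2^-1.
Hypothesis lam_alpha : 4 * d.+1%:R ^+ 2 * lam * beta <= alpha.
Hypothesis fg_lip : locally_lipschitz f g.
Hypothesis g_bound : forall x, fnorm (g x) ^+ 2 <= beta.
Hypothesis h_bound : forall x, 0 < h x <= hmax.
Hypothesis f_drift : forall x,
  dotv x (f x) + 2^-1 * h x * fnorm (f x) ^+ 2 <= - alpha * fnorm x ^+ 2 + beta.

Let C := lyap_const d hmax alpha beta lam.

Lemma hmax_ge0 : 0 <= hmax.
Proof. by have /andP[/ltW + /(le_trans _)] := h_bound 0; move=> h0; apply. Qed.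

Lemma C_ge0 : 0 <= C.
Proof.
rewrite !mulr_ge0 ?expR_ge0//; apply/ltW/lyap_drift_gt0 => //;
  by [exact: hmax_ge0|exact: ltW].
Qed.

Lemma measurable_entries_f disp' (U : measurableType disp') (X : U -> 'cV[R]_m) :
  measurable_entries X -> measurable_entries (f \o X).
Proof.
move=> mX i j; apply: (measurable_seq_continuous (phi := fun x => f x i j)) => //.
by move=> u l /(locally_lipschitz_entry_cvg fg_lip)[+ _]; exact.
Qed.

Lemma measurable_entries_g disp' (U : measurableType disp') (X : U -> 'cV[R]_m) :
  measurable_entries X -> measurable_entries (g \o X).
Proof.
move=> mX i j; apply: (measurable_seq_continuous (phi := fun x => g x i j)) => //.
by move=> u l /(locally_lipschitz_entry_cvg fg_lip)[_ +]; exact.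
Qed.

Lemma measurable_em_move s t (X : T -> 'cV[R]_m) : 0 <= s -> s <= t ->
  measurable_entries (X : g_sigma_algebraType (F s) -> _) ->
  measurable_entries ((fun w => em_move W f g s t (X w) w) :
    g_sigma_algebraType (F t) -> _).
Proof.
move=> s0 st mX; have t0 := le_trans s0 st; case: (FF) => sF mF nF.
have st_sub := nF _ _ s0 st.
have mX' := measurable_entries_sigmaS (sF _ s0) (sF _ t0) st_sub mX.
have mWs := measurable_entries_sigmaS (sF _ s0) (sF _ t0) st_sub
  (brownian_adapted FF BW s0).
have mWt := brownian_adapted FF BW t0.
apply: measurable_entriesD; first apply: measurable_entriesD => //.
  by apply: measurable_entriesZ; exact: measurable_entries_f.
apply: measurable_entries_mulmx; first exact: measurable_entries_g.
apply: measurable_entriesD => // i j.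
rewrite (_ : (fun w => _) = (fun w => - W s w i j)).
  by apply: measurable_funN; exact: mWs.
by apply/funext => w; rewrite mxE.
Qed.

Lemma measurable_lyap disp' (U : measurableType disp') (X : U -> 'cV[R]_m) :
  measurable_entries X -> measurable_fun setT (lyap lam \o X).
Proof.
by move=> mX; apply: measurable_seq_continuous => //; exact: seq_continuous_lyap.
Qed.

(** The noise is integrated out first; the drift estimate and the contraction then hold pointwise on
    the event [A] known at time [s]. *)
Lemma integral_lyap_em_move s t (X : T -> 'cV[R]_m) (A : set T) :
  0 <= s -> s <= t -> t - s <= hmax -> F s A ->
  measurable_entries (X : g_sigma_algebraType (F s) -> _) ->
  (forall w, A w -> t - s <= h (X w)) ->
  (\int[P]_(w in A) (expR (t - s) * lyap lam (em_move W f g s t (X w) w))%:E <=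
   \int[P]_(w in A) (lyap lam (X w) + C * (t - s))%:E)%E.
Proof.
move=> s0 st th FA mX hA; have t0 := le_trans s0 st.
case: (FF) => sF mF nF; have mA := mF _ s0 _ FA.
have mX' := measurable_entries_sub_sigma (sF _ s0) (mF _ s0) mX.
have ms := measurable_em_move s0 st mX.
have ms' := measurable_entries_sub_sigma (sF _ t0) (mF _ t0) ms.
have mr : measurable_fun A (fun w => (lyap lam (X w) + C * (t - s))%:E).
  apply/measurable_EFinP/measurable_funTS; apply: measurable_funD => //.
  exact: measurable_lyap.
(* The Gaussian law of the increment is given only for [s < t]; when [s = t] the move is the
   identity. *)
have [ts|sneqt] := eqVneq s t.
  subst t.
  apply: ge0_le_integral => //.
  - by move=> w _; rewrite lee_fin mulr_ge0 ?expR_ge0 ?lyap_ge0.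
  - apply/measurable_EFinP/measurable_funTS; apply: measurable_funM => //.
    rewrite (_ : (fun w => _) = lyap lam \o X); first exact: measurable_lyap.
    by apply/funext => w /=; rewrite /em_move !subrr scale0r mulmx0 !addr0.
  - move=> w _; rewrite /em_move !subrr scale0r mulmx0 !addr0.
    by rewrite expR0 mul1r mulr0 addr0.
have {sneqt}st' : s < t by rewrite lt_neqAle sneqt.
set dl := t - s in th hA mr *.
have dl0 : 0 < dl by rewrite subr_gt0.
have dlh : 0 <= dl <= hmax by rewrite ltW.
pose y w := X w + dl *: f (X w).
have my : measurable_entries (y : g_sigma_algebraType (F s) -> _).
  apply: measurable_entriesD => //.
  by apply: measurable_entriesZ; exact: measurable_entries_f.
have small : 2 * (d.+1%:R * lam * beta) * dl <= 2^-1.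
  apply: le_trans lam_small; rewrite ler_wpM2l// !mulr_ge0//; exact: ltW.
have noise := integral_lyap_noise (sF _ s0) (mF _ s0) beta_gt0 lam_gt0 dl0
  small my (measurable_entries_g mX) (measurable_increment FF BW s0 st)
  (fun i B D GB mD => increment_indep BW i s0 st' GB mD) FA
  (fun w => g_bound (X w)).
have mlhs : measurable_fun A (fun w => (lyap lam (em_move W f g s t (X w) w))%:E).
  by apply/measurable_EFinP/measurable_funTS; exact: measurable_lyap.
under eq_integral do rewrite EFinM.
rewrite ge0_integralZl//; last first.
  by move=> w _; rewrite lee_fin lyap_ge0.
apply: (le_trans (lee_wpmul2l _ noise)); first by rewrite lee_fin expR_ge0.
have mn : measurable_fun setT (fun w => expR (lam * fnorm (y w) ^+ 2 +
     (2 * (d.+1%:R * lam * beta) * dl +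
      4 * d.+1%:R ^+ 2 * lam ^+ 2 * beta * fnorm (y w) ^+ 2 * dl))).
  have mfy : measurable_fun setT (fun w => fnorm (y w) ^+ 2).
    have my' := measurable_entries_sub_sigma (sF _ s0) (mF _ s0) my.
    exact: measurable_fnorm_sqr.
  apply: measurableT_comp => //; apply: measurable_funD; first exact: measurable_funM.
  apply: measurable_funD => //; apply: measurable_funM => //.
  exact: measurable_funM.
rewrite -ge0_integralZl//; last first.
  exact/measurable_EFinP/measurable_funTS.
apply: ge0_le_integral => //.
- apply: emeasurable_funM => //; exact/measurable_EFinP/measurable_funTS.
- move=> w Aw; rewrite -EFinM lee_fin.
  have dlX : 0 <= dl <= h (X w) by rewrite ltW//= hA.
  have yX := drift_bound (f_drift (X w)) dlX.
  apply: (@le_trans _ _ (expR dl * expR (lam * fnorm (X w) ^+ 2 -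
      alpha * dl * (lam * fnorm (X w) ^+ 2) +
      (lyap_drift d hmax alpha beta lam - 1) * dl))).
    rewrite ler_wpM2l ?expR_ge0// ler_expR.
    by apply: lyap_exponent_le => //; rewrite ?sqr_ge0.
  apply: lyap_contraction => //; rewrite ?hmax_ge0//; try exact: ltW.
  by rewrite mulr_ge0 ?sqr_ge0// ltW.
Qed.

(** The second summand is a reserve for the additive errors still to come before the horizon
    [t1]. *)
Definition lyap_time (t1 : R) (p : R * 'cV[R]_m) : R :=
  expR p.1 * lyap lam p.2 + C * (expR t1 - expR p.1).

Lemma lyap_time_ge0 t1 p : p.1 <= t1 -> 0 <= lyap_time t1 p.
Proof.
move=> pt; rewrite addr_ge0// mulr_ge0 ?expR_ge0 ?lyap_ge0 ?C_ge0//.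
by rewrite subr_ge0 ler_expR.
Qed.

Lemma measurable_lyap_time t1 s disp' (U : measurableType disp')
    (X : U -> 'cV[R]_m) :
  measurable_entries X -> measurable_fun setT (fun w => lyap_time t1 (s, X w)).
Proof.
move=> mX; rewrite /lyap_time/=; apply: measurable_funD; last exact: measurable_cst.
by apply: measurable_funM; [exact: measurable_cst|exact: measurable_lyap].
Qed.

(** The step costs [expR s * C * (t - s)], and the reserve falls by [C * (expR t - expR s)], which
    is at least as much because [1 + (t - s) <= expR (t - s)]. *)
Lemma integral_lyap_time_em_move t1 s t (X : T -> 'cV[R]_m) (A : set T) :
  0 <= s -> s <= t -> t <= t1 -> t - s <= hmax -> F s A ->
  measurable_entries (X : g_sigma_algebraType (F s) -> _) ->
  (forall w, A w -> t - s <= h (X w)) ->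
  (\int[P]_(w in A) (lyap_time t1 (t, em_move W f g s t (X w) w))%:E <=
   \int[P]_(w in A) (lyap_time t1 (s, X w))%:E)%E.
Proof.
move=> s0 st tt1 th FA mX hA; have t0 := le_trans s0 st.
case: (FF) => sF mF _; have mA := mF _ s0 _ FA.
have mX' := measurable_entries_sub_sigma (sF _ s0) (mF _ s0) mX.
have ms := measurable_em_move s0 st mX.
have ms' := measurable_entries_sub_sigma (sF _ t0) (mF _ t0) ms.
pose a w := expR (t - s) * lyap lam (em_move W f g s t (X w) w).
pose b w := lyap lam (X w) + C * (t - s).
pose c := C * (expR t1 - expR t).
have c0 : 0 <= c by rewrite mulr_ge0 ?C_ge0// subr_ge0 ler_expR.
have a0 w : 0 <= a w by rewrite mulr_ge0 ?expR_ge0 ?lyap_ge0.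
have b0 w : 0 <= b w by rewrite addr_ge0 ?lyap_ge0// mulr_ge0 ?C_ge0// subr_ge0.
have ma : measurable_fun setT a.
  by apply: measurable_funM => //; exact: measurable_lyap.
have mb : measurable_fun setT b.
  by apply: measurable_funD => //; exact: measurable_lyap.
have split_int (u : T -> R) : (forall w, 0 <= u w) -> measurable_fun setT u ->
    (\int[P]_(w in A) (expR s * u w + c)%:E =
     (expR s)%:E * \int[P]_(w in A) (u w)%:E + \int[P]_(w in A) c%:E)%E.
  move=> u0 mu.
  have mu' : measurable_fun A (fun w => (u w)%:E).
    by apply/measurable_EFinP; exact: measurable_funTS.
  under eq_integral do rewrite EFinD.
  rewrite ge0_integralD//; last 2 first.
  - by move=> w _; rewrite lee_fin mulr_ge0 ?expR_ge0.
  - by under eq_fun do rewrite EFinM; exact: emeasurable_funM.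
  under eq_integral do rewrite EFinM.
  by rewrite ge0_integralZl// => w _; rewrite lee_fin.
have -> : (\int[P]_(w in A) (lyap_time t1 (t, em_move W f g s t (X w) w))%:E =
    \int[P]_(w in A) (expR s * a w + c)%:E)%E.
  apply: eq_integral => w _; rewrite /lyap_time /a mulrA -expRD.
  by rewrite subrKC.
rewrite split_int//.
apply: (@le_trans _ _ ((expR s)%:E * \int[P]_(w in A) (b w)%:E +
    \int[P]_(w in A) c%:E)%E).
  rewrite leeD2r// lee_wpmul2l ?lee_fin ?expR_ge0//.
  exact: integral_lyap_em_move.
rewrite -split_int//; apply: ge0_le_integral => //.
- by move=> w _; rewrite lee_fin addr_ge0// mulr_ge0 ?expR_ge0.
- apply/measurable_EFinP/measurable_funTS; apply: measurable_funD => //.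
  exact: measurable_funM.
- by apply/measurable_EFinP/measurable_funTS; exact: measurable_lyap_time.
- move=> w _; rewrite lee_fin /lyap_time /b /c /= mulrDr -addrA lerD2l.
  rewrite mulrCA -mulrDr ler_wpM2l ?C_ge0//.
  have : expR s * (1 + (t - s)) <= expR s * expR (t - s).
    by rewrite ler_wpM2l ?expR_ge0// expR_ge1Dx.
  by rewrite -expRD subrKC; lra.
Qed.

(* The first step of the chain leaves from a deterministic time, and on the
   event that it lands on l / (k + 1) the remaining chain starts again at a
   deterministic time; the induction on n therefore never meets a random time. *)
Lemma grid_chain_supermartingale t1 th k n i (A : set T) (X : T -> 'cV[R]_m) :
  (forall s x, 0 <= s -> 0 <= th s x <= h x) ->
  (forall s x, 0 <= s <= t1 -> s + th s x <= t1) ->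
  (forall s, 0 <= s -> seq_continuous (th s)) ->
  let s := i%:R / k.+1%:R in
  s <= t1 -> F s A ->
  measurable_entries (X : g_sigma_algebraType (F s) -> _) ->
  exists G : T -> \bar R, [/\ measurable_fun setT G, forall w, (0 <= G w)%E,
    forall w, A w ->
      ((lyap_time t1 (iter n (em_step W f g (floor_step k th) w) (s, X w)))%:E
        <= G w)%E
    & (\int[P]_(w in A) G w <= \int[P]_(w in A) (lyap_time t1 (s, X w))%:E)%E].
Proof.
move=> th_bd th_t1 th_cont.
have k0 : 0 < k.+1%:R :> R by rewrite ltr0n.
have grid0 l : 0 <= l%:R / k.+1%:R :> R by rewrite divr_ge0.
case: (FF) => sF mF nF.
elim: n i A X => [|n IH] i A X s st1 FA mX.
  exists (fun w => (lyap_time t1 (s, X w))%:E); split => //.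
  - apply/measurable_EFinP/measurable_lyap_time.
    exact: (measurable_entries_sub_sigma (sF _ (grid0 i)) (mF _ (grid0 i)) mX).
  - by move=> w; rewrite lee_fin lyap_time_ge0.
have s0 : 0 <= s := grid0 i.
have mX' := measurable_entries_sub_sigma (sF _ s0) (mF _ s0) mX.
(* The first step lands on grid point [j w]. The landing event [Al l] belongs to [F s] because [X],
   and with it the step, is known at time [s]. *)
pose j w := Num.truncn ((s + th s (X w)) * k.+1%:R).
pose Al l := A `&` [set w | j w = l].
have sth0 w : 0 <= s + th s (X w).
  by have /andP[? _] := th_bd s (X w) s0; rewrite addr_ge0.
have j_ge w : (i <= j w)%N.
  rewrite /j truncn_ge_nat; last by rewrite mulr_ge0.
  rewrite mulrDl /s divfK ?gt_eqF// lerDl mulr_ge0//.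
  by have /andP[] := th_bd s (X w) s0.
have j_le w : (j w)%:R / k.+1%:R <= s + th s (X w) by exact: floor_mesh_le.
have FAl l : F s (Al l).
  rewrite -(measurable_g_measurableTypeE (sF _ s0)); apply: measurableI.
    by rewrite measurable_g_measurableTypeE; [|exact: sF].
  rewrite (_ : [set w | _] = setT `&` (fun w => (s + th s (X w)) * k.+1%:R) @^-1`
      `[l%:R, l.+1%:R[%classic).
    have : measurable_fun setT ((fun w => (s + th s (X w)) * k.+1%:R) :
        g_sigma_algebraType (F s) -> R).
      apply: measurable_funM => //; apply: measurable_funD => //.
      exact: (measurable_seq_continuous (th_cont s s0) mX).
    by apply => //; exact: measurable_itv.
  apply/seteqP; split => w /=; rewrite in_itv/=.
    by move=> <-; split => //; apply: truncn_itv; rewrite mulr_ge0.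
  by move=> [_ /truncn_def].
have /choice[G HG] : forall l, exists G : T -> \bar R,
    [/\ measurable_fun setT G, forall w, (0 <= G w)%E,
     forall w, Al l w -> ((lyap_time t1 (iter n.+1 (em_step W f g (floor_step k th) w)
        (s, X w)))%:E <= G w)%E
     & (\int[P]_(w in Al l) G w <=
        \int[P]_(w in Al l) (lyap_time t1 (s, X w))%:E)%E].
  (* A point of [Al l] turns the bounds on the step into inequalities between [s], [t] and [t1]; an
     empty event receives the zero majorant. *)
  move=> l; have [[w0 [Aw0 /= jw0]]|Al0] := pselect (Al l !=set0); last first.
    exists (cst 0%E); split => //.
    + by move=> w Alw; exfalso; apply: Al0; exists w.
    + rewrite integral0; apply: integral_ge0 => w _.
      by rewrite lee_fin lyap_time_ge0.
  pose t := l%:R / k.+1%:R : R.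
  have t0 : 0 <= t := grid0 l.
  have st : s <= t by rewrite ler_pM2r ?invr_gt0// ler_nat -jw0 j_ge.
  have t_le w : Al l w -> t <= s + th s (X w) by move=> [_ /= jl]; rewrite /t -jl.
  have tt1 : t <= t1.
    by apply: le_trans (th_t1 s (X w0) _); [exact: t_le|rewrite s0].
  have dth w : Al l w -> t - s <= h (X w).
    move=> /t_le; rewrite lerBlDl => /le_trans; apply.
    by rewrite lerD2l; have /andP[] := th_bd s (X w) s0.
  have dthmax : t - s <= hmax.
    by apply: (le_trans (dth w0 _)) => //; have /andP[] := h_bound (X w0).
  have FtAl : F t (Al l) := nF _ _ s0 st _ (FAl l).
  have [G [mG G0 QG intG]] := IH l (Al l) _ tt1 FtAl (measurable_em_move s0 st mX).
  exists G; split; [exact: mG|exact: G0| |].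
  - move=> w Alw; rewrite -iterS iterSr; apply: le_trans (QG w Alw).
    have -> : em_step W f g (floor_step k th) w (s, X w) =
        (t, em_move W f g s t (X w) w).
      have st_eq : s + floor_step k th s (X w) = t.
        rewrite /floor_step subrKC /floor_mesh.
        by case: Alw => _ /= jl; rewrite /t -jl.
      by rewrite /em_step /= st_eq.
    by [].
  - by apply: (le_trans intG); exact: integral_lyap_time_em_move.
(* No step passes [t1], so only finitely many landing events occur. *)
pose L := (Num.truncn (t1 * k.+1%:R)).+1.
have j_lt w : (j w < L)%N.
  rewrite ltnS; apply: le_truncn; rewrite ler_pM2r//.
  by apply: th_t1; rewrite s0.
have mAl l : measurable (Al l) := mF _ s0 _ (FAl l).
have mA : measurable A := mF _ s0 _ FA.
(* The landing events partition [A], and the majorants are glued along them. *)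
exists (fun w => \sum_(l < L) (G l w * (\1_(Al l) w)%:E))%E; split.
- apply: emeasurable_sum => l; apply: emeasurable_funM; first by case: (HG l).
  by apply/measurable_EFinP; exact: measurable_indic.
- move=> w; apply: sume_ge0 => l _; rewrite mule_ge0//.
  by case: (HG l).
- move=> w Aw; have Alw : Al (j w) w by split.
  rewrite (bigD1 (Ordinal (j_lt w)))//= indicE mem_set// mule1.
  case: (HG (j w)) => _ _ QG _; apply: (le_trans (QG w Alw)).
  rewrite leeDl// sume_ge0// => l _; rewrite mule_ge0//.
  by case: (HG l).
- rewrite ge0_integral_sum//; last 2 first.
  + move=> l; apply: measurable_funTS; apply: emeasurable_funM; first by case: (HG l).
    by apply/measurable_EFinP; exact: measurable_indic.
  + by move=> l w _; rewrite mule_ge0//; case: (HG l).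
  apply: (@le_trans _ _ (\sum_(l < L) \int[P]_(w in A)
      ((lyap_time t1 (s, X w))%:E * (\1_(Al l) w)%:E))%E).
    apply: lee_sum => l _; case: (HG l) => _ _ _.
    have AlA : Al l `<=` A by move=> w [].
    by rewrite !(integral_mul_indic_sub P _ AlA).
  rewrite -ge0_integral_sum//; last 2 first.
  + move=> l; apply: measurable_funTS; apply: emeasurable_funM; last first.
      by apply/measurable_EFinP; exact: measurable_indic.
    by apply/measurable_EFinP; exact: measurable_lyap_time.
  + by move=> l w _; rewrite mule_ge0// lee_fin ?lyap_time_ge0.
  apply: ge0_le_integral => //.
  + by move=> w _; apply: sume_ge0 => l _; rewrite mule_ge0// lee_fin ?lyap_time_ge0.
  + apply: measurable_funTS; apply: emeasurable_sum => l.
    apply: emeasurable_funM; last by apply/measurable_EFinP; exact: measurable_indic.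
    by apply/measurable_EFinP; exact: measurable_lyap_time.
  + by apply/measurable_EFinP/measurable_funTS; exact: measurable_lyap_time.
  + move=> w Aw; rewrite (bigD1 (Ordinal (j_lt w)))//= big1 => [|l /eqP jl].
      by rewrite adde0 indicE mem_set ?mule1//; split.
    rewrite indicE memNset ?mule0// => -[_ /= jwl]; apply: jl.
    exact: val_inj.
Qed.

(** * Passage to the interpolants at a fixed time, and the moment bound *)

Hypothesis h_cont : continuous h.
Context (t : R) (t_ge0 : 0 <= t) (x0 : 'cV[R]_m).

(** The horizon exceeds [t] by one because a soft step with [e <= 1] may end as late as [t + e]. *)
Let t1 := t + 1.
Let Q : R * 'cV[R]_m -> R := lyap_time t1.
Let chain th n w := iter n (em_step W f g th w) (0, x0).

Let W_cont w : {within [set u : R | 0 <= u], continuous (W ^~ w)}.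
Proof. by case: BW. Qed.

Lemma lyap_time_cvg (ss : nat -> R) s (xs : nat -> 'cV[R]_m) x :
  ss k @[k --> \oo] --> s -> entry_cvg xs x ->
  Q (ss k, xs k) @[k --> \oo] --> Q (s, x).
Proof.
move=> sss xsx; rewrite /Q /lyap_time /=.
have ess : expR (ss k) @[k --> \oo] --> expR s.
  exact: (cvg_comp ss expR sss (@continuous_expR R s)).
apply: cvgD; apply: cvgM.
- exact: ess.
- exact: seq_continuous_lyap.
- exact: cvg_cst.
- by apply: cvgB => //; exact: cvg_cst.
Qed.

(** For the rounded chains this is the supermartingale bound from the grid time [0] on the whole
    space; as the mesh tends to zero they converge pathwise, by continuity of [th]. *)
Lemma upper_mean_chain th n :
  (forall s x, 0 <= s -> 0 <= th s x <= h x) ->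
  (forall s x, 0 <= s <= t1 -> s + th s x <= t1) ->
  joint_continuous th ->
  upper_mean_le P (fun w => Q (chain th n w)) (Q (0, x0)).
Proof.
move=> th_bd th_t1 th_cont.
have th0 s x : 0 <= s -> 0 <= th s x by move=> /(th_bd s x)/andP[].
apply: (@upper_mean_cvg _ _ _ _ (fun k w => Q (chain (floor_step k th) n w))).
  move=> k.
  have s0E : 0%:R / k.+1%:R = 0 :> R by rewrite mul0r.
  have sc s : 0 <= s -> seq_continuous (th s).
    by move=> _ u l ul; apply: th_cont => //; exact: cvg_cst.
  have [|||G [mG G0 QG intG]] :=
    @grid_chain_supermartingale t1 th k n 0%N setT (cst x0) th_bd th_t1 sc.
  - by rewrite s0E addr_ge0.
  - case: FF => sF _ _; rewrite s0E; have [F0 FC FU] := sF 0 (lexx 0).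
    by rewrite -(setD0 setT); exact: FC.
  - by move=> i j; exact: measurable_cst.
  move: QG intG; rewrite s0E => QG intG.
  exists G; split => //; first by move=> w; exact: QG.
  apply: (le_trans intG).
  rewrite [leLHS](_ : _ = \int[P]_w (cst (Q (0, x0))%:E w))%E//.
  by rewrite integral_cst// [X in (_ * X)%E](probability_setT P) mule1.
move=> w.
have [|||p0 q0 pq1 pq2] := @iter_em_step_cvg _ _ _ _ _ W f g fg_lip W_cont
  w (fun k => floor_step k th) th x0 n.
- by move=> k s x _; rewrite /floor_step subrKC floor_mesh_ge0.
- by move=> s x s0; rewrite addr_ge0// th0.
- by move=> ss s xs x ss0 s0 sss xsx; exact: floor_step_cvg.
have := lyap_time_cvg pq1 pq2; rewrite /chain -surjective_pairing.
by under eq_fun do rewrite -surjective_pairing.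
Qed.

Lemma upper_mean_capped n :
  upper_mean_le P (fun w => Q (chain (capped_step h t) n w)) (Q (0, x0)).
Proof.
apply: upper_mean_chain => [s x s0|s x /andP[s0 st]|ss s xs x sss xsx].
- rewrite ge_min lexx andbT le_min le_max lexx/= andbT.
  by have /andP[/ltW] := h_bound x.
- apply: (@le_trans _ _ (s + Num.max 0 (t - s))).
    by rewrite lerD2l ge_min lexx orbT.
  have [ts|ts] := leP 0 (t - s); last by rewrite addr0.
  by rewrite subrKC /t1 lerDl.
- apply: cvg_min; first exact: (continuous_seq h_cont).
  by apply: cvg_max; [exact: cvg_cst|apply: cvgB => //; exact: cvg_cst].
Qed.

Lemma upper_mean_soft e n : 0 < e <= 1 ->
  upper_mean_le P (fun w => Q (chain (soft_step h t e) n w)) (Q (0, x0)).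
Proof.
move=> /andP[e0 e1].
apply: upper_mean_chain => [s x s0|s x /andP[s0 st]|ss s xs x sss xsx].
- have /andP[/ltW h0 _] := h_bound x.
  rewrite mulr_ge0//=; last by rewrite le_min ler01 le_max lexx.
  by rewrite ler_piMr// ge_min lexx.
- have /andP[/ltW h0 _] := h_bound x.
  rewrite /soft_step; have [le0|gt0] := leP ((t + e - s - h x) / e) 0.
    by rewrite min_r// mulr0 addr0.
  apply: (@le_trans _ _ (s + h x)).
    by rewrite lerD2l ler_piMr// ge_min lexx.
  by move: gt0; rewrite pmulr_lgt0 ?invr_gt0// /t1 => ?; lra.
- have hx := continuous_seq h_cont xsx.
  apply: cvgM => //; apply: cvg_min; first exact: cvg_cst.
  apply: cvg_max; first exact: cvg_cst.
  apply: cvgM; last exact: cvg_cst.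
  by apply: cvgB => //; apply: cvgB => //; exact: cvg_cst.
Qed.

Lemma upper_mean_frozen n :
  upper_mean_le P (fun w => Q (chain (frozen_step h t) n w)) (Q (0, x0)).
Proof.
apply: (@upper_mean_cvg _ _ _ _ (fun j w => Q (chain (soft_step h t j.+1%:R^-1) n w))).
  by move=> j; apply: upper_mean_soft; rewrite invr_gt0 ltr0n/= invf_le1 ?ler1n.
move=> w; apply: cvg_near_cst.
suff : \forall j \near \oo,
    chain (soft_step h t j.+1%:R^-1) n w = chain (frozen_step h t) n w.
  by apply: filterS => j ->.
rewrite /chain; elim: n => [|n IH]; first exact: nearW.
near=> j; rewrite /=.
have -> : iter n (em_step W f g (soft_step h t j.+1%:R^-1) w) (0, x0) =
  iter n (em_step W f g (frozen_step h t) w) (0, x0) by near: j; exact: IH.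
rewrite /em_step.
suff -> : soft_step h t j.+1%:R^-1
    (iter n (em_step W f g (frozen_step h t) w) (0, x0)).1
    (iter n (em_step W f g (frozen_step h t) w) (0, x0)).2 =
  (frozen_step h t) (iter n (em_step W f g (frozen_step h t) w) (0, x0)).1
    (iter n (em_step W f g (frozen_step h t) w) (0, x0)).2 by [].
by near: j; exact: soft_step_eventually.
Unshelve. all: by end_near. Qed.

Lemma lyap_le_lyap_time p : p.1 <= t1 -> expR p.1 * lyap lam p.2 <= Q p.
Proof.
move=> pt; rewrite /Q /lyap_time lerDl mulr_ge0 ?C_ge0//.
by rewrite subr_ge0 ler_expR.
Qed.

Let tn w n := em_time f g h x0 (W ^~ w) n.
Let xn w n := em_state f g h x0 (W ^~ w) n.

Lemma lyap_time_escape w y : (forall k, tn w k <= t) ->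
  \forall k \near \oo, y <= Q (tn w k, xn w k).
Proof.
move=> bad; have esc := em_state_escape h_bound h_cont bad.
apply: filterS (lyap_ge_eventually y lam_gt0 esc) => k yk.
apply: le_trans (lyap_le_lyap_time _); last first.
  by rewrite /= (le_trans (bad k))// lerDl.
apply: (le_trans yk); rewrite ler_peMl ?lyap_ge0//= -expR0 ler_expR.
exact: em_time_ge0 h_bound _ _.
Qed.

(** On a path whose grid passes [t], the capped chain comes to rest at the interpolant; on any other
    path it is the scheme itself, along which [Q] eventually exceeds every [y]. *)
Lemma upper_mean_interp :
  upper_mean_le P (fun w => expR t * lyap lam (em_interp f g h x0 (W ^~ w) t))
    (Q (0, x0)).
Proof.
apply: (upper_mean_fatou (upper_mean_capped)) => w y yZ.
have [[nt tn1]|bad] := em_indexP W f g x0 h_bound w t_ge0.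
  exists (em_index f g h x0 (W ^~ w) t).+1 => // k /= nk.
  rewrite /chain -(subnK nk) (chain_capped_after h_bound _ nt tn1).
  apply: (le_trans (ltW yZ)); apply: (lyap_le_lyap_time (p := (t, _))).
  by rewrite lerDl.
apply: filterS (lyap_time_escape y bad) => k yk.
by rewrite /chain (chain_capped h_bound (bad k)).
Qed.

Lemma upper_mean_piecewise :
  upper_mean_le P
    (fun w => expR (t - hmax) * lyap lam (em_piecewise f g h x0 (W ^~ w) t))
    (Q (0, x0)).
Proof.
apply: (upper_mean_fatou (upper_mean_frozen)) => w y yZ.
have [[nt tn1]|bad] := em_indexP W f g x0 h_bound w t_ge0.
  exists (em_index f g h x0 (W ^~ w) t) => // k /= nk.
  rewrite /chain -(subnK nk) (chain_frozen_after h_bound _ nt tn1).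
  apply: (le_trans (ltW yZ)).
  apply: le_trans (lyap_le_lyap_time (p := (_, _)) _); last first.
    by rewrite /= (le_trans nt)// lerDl.
  rewrite ler_wpM2r ?lyap_ge0// ler_expR lerBlDr ltW//.
  apply: (lt_le_trans tn1); rewrite em_timeS lerD2l.
  by case/andP: (h_bound (xn w (em_index f g h x0 (W ^~ w) t))).
apply: filterS (lyap_time_escape y bad) => k yk.
by rewrite /chain (chain_frozen h_bound (bad k)).
Qed.

(** The initial value grows at most like [expR t], which the weight of the Lyapunov function
    cancels; this makes the moment bound uniform in [t]. *)
Lemma lyap_time_start_le : Q (0, x0) <= expR t * (lyap lam x0 + C * expR 1).
Proof.
rewrite /Q /lyap_time /= expR0 mul1r [leRHS]mulrDr lerD//.
  by rewrite ler_peMl ?lyap_ge0// -expR0 ler_expR.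
by rewrite mulrCA -expRD ler_wpM2l ?C_ge0// gerBl ler01.
Qed.

(** The delay [e] lets one statement serve both interpolants: [0] for the continuous one, [hmax] for
    the piecewise constant one. *)
Lemma expectation_moment_le (Y : T -> 'cV[R]_m) (p e : R) :
  0 < p -> 0 <= e <= hmax ->
  upper_mean_le P (fun w => expR (t - e) * lyap lam (Y w)) (Q (0, x0)) ->
  ('E_P[fun w => (fnorm (Y w) `^ p)%R] <=
   (expR (p ^+ 2 / (4 * lam)) * (expR hmax * (lyap lam x0 + C * expR 1)))%:E)%E.
Proof.
move=> p0 /andP[e0 eh] uY.
set K := expR (p ^+ 2 / (4 * lam)).
have K0 : 0 <= K * expR (e - t) by rewrite mulr_ge0 ?expR_ge0.
apply: (le_trans (expectation_upper_mean (a := K * expR (e - t)) K0 uY _)).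
  move=> w; rewrite powR_ge0/= -mulrA (mulrA (expR _)) -expRD.
  by rewrite addrA subrK subrr expR0 mul1r powR_le_lyap.
rewrite lee_fin -mulrA ler_wpM2l ?expR_ge0//.
apply: (le_trans (ler_wpM2l (expR_ge0 _) lyap_time_start_le)).
rewrite mulrA -expRD subrK ler_wpM2r ?ler_expR//.
by rewrite addr_ge0 ?lyap_ge0// mulr_ge0 ?C_ge0// expR_ge0.
Qed.

End em_moments.

(** * Choice of the exponent and of the moment constant *)

Theorem theorem1 (R : realType) (m d : nat) (p : R) (x0 : 'cV[R]_m)
    (hmax alpha beta : R) (p_gt0 : 0 < p) (hmax_gt0 : 0 < hmax)
    (alpha_gt0 : 0 < alpha) (beta_gt0 : 0 < beta) :
  exists Cp : R,
    forall (f : 'cV[R]_m -> 'cV[R]_m) (g : 'cV[R]_m -> 'M[R]_(m, d))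
           (h : 'cV[R]_m -> R),
      locally_lipschitz f g ->
      (forall x, dotv x (f x) <= - alpha * fnorm x ^+ 2 + beta) ->
      (forall x, fnorm (g x) ^+ 2 <= beta) ->
      (forall x, g x *m (g x)^T \in unitmx) ->
      (forall x, 0 < h x <= hmax) ->
      continuous h ->
      (forall x, dotv x (f x) + 2^-1 * h x * fnorm (f x) ^+ 2
                 <= - alpha * fnorm x ^+ 2 + beta) ->
    forall (disp : measure_display) (T : measurableType disp)
           (P : probability T R) (F : R -> set (set T))
           (W : R -> T -> 'cV[R]_d),
      filtration F -> brownian_motion P F W ->
    forall t : R, 0 <= t ->
      ('E_P[fun w => (fnorm (em_interp f g h x0 (W ^~ w) t) `^ p)%R] < Cp%:E)%E /\
      ('E_P[fun w => (fnorm (em_piecewise f g h x0 (W ^~ w) t) `^ p)%R] < Cp%:E)%E.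
Proof.
set N : R := d.+1%:R.
have N0 : 0 < N by rewrite ltr0n.
(* The first bound keeps the Gaussian integrals under control for all steps up to [hmax]; the second
   lets dissipation pay for the noise. *)
pose lam := Num.min ((4 * N * beta * hmax)^-1) (alpha / (4 * N ^+ 2 * beta)).
have lam_gt0 : 0 < lam.
  by rewrite lt_min invr_gt0 divr_gt0// !mulr_gt0// exprn_gt0.
have lam_small : 2 * (N * lam * beta) * hmax <= 2^-1.
  have : lam <= (4 * N * beta * hmax)^-1 by rewrite ge_min lexx.
  rewrite -[X in _ <= X]mul1r ler_pdivlMr; last by rewrite !mulr_gt0.
  lra.
have lam_alpha : 4 * N ^+ 2 * lam * beta <= alpha.
  have : lam <= alpha / (4 * N ^+ 2 * beta) by rewrite ge_min lexx orbT.
  rewrite ler_pdivlMr; last by rewrite !mulr_gt0// exprn_gt0.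
  lra.
(* The final [1] makes the inequalities strict. *)
exists (expR (p ^+ 2 / (4 * lam)) * (expR hmax *
  (lyap lam x0 + lyap_const d hmax alpha beta lam * expR 1)) + 1).
move=> f g h fg_lip _ g_bound _ h_bound h_cont f_drift disp T P F W FF BW t t_ge0.
set c := _ * _.
have c1 : (c%:E < (c + 1)%:E)%E by rewrite lte_fin ltrDl.
split; apply: le_lt_trans c1.
- apply: (expectation_moment_le alpha_gt0 beta_gt0 lam_gt0 h_bound t_ge0 p_gt0
    (e := 0)); first by rewrite lexx ltW.
  rewrite subr0.
  exact: (upper_mean_interp FF BW alpha_gt0 beta_gt0 lam_gt0 lam_small lam_alpha
    fg_lip g_bound h_bound f_drift h_cont t_ge0).
- apply: (expectation_moment_le alpha_gt0 beta_gt0 lam_gt0 h_bound t_ge0 p_gt0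
    (e := hmax)); first by rewrite lexx ltW.
  exact: (upper_mean_piecewise FF BW alpha_gt0 beta_gt0 lam_gt0 lam_small lam_alpha
    fg_lip g_bound h_bound f_drift h_cont t_ge0).
Qed.
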